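(* Let $Q\in\mathcal B$ and $0<\alpha<1$. Suppose $\mathcal H^{\alpha,0}(\Lambda,\phi_0)(Q)>0$. Then (i) $$\Xi^{\alpha,\alpha}_1(Q)-\Psi^{\alpha,\alpha}_1(Q)\le-\frac{\mathcal H^{\alpha,0}(\Lambda,\phi_0)(Q)}{\alpha(1-\alpha)}\log\frac{\mathcal H^{\alpha,0}(\Lambda,\phi_0)(Q)}{\Phi(Q)^{1-\alpha}\Lambda(Q)^\alpha},$$ (ii) $$e^{W_{-1}\left(\frac{\alpha(1-\alpha)\left(\Psi^{\alpha,\alpha}_1(Q)-\Xi^{\alpha,\alpha}_1(Q)\right)}{\Phi(Q)^{1-\alpha}\Lambda(Q)^{\alpha}}\right)}\Phi(Q)^{1-\alpha}\Lambda(Q)^\alpha\le\mathcal H^{\alpha,0}(\Lambda,\phi_0)(Q)\le e^{W\left(\frac{\alpha(1-\alpha)\left(\Psi^{\alpha,\alpha}_1(Q)-\Xi^{\alpha,\alpha}_1(Q)\right)}{\Phi(Q)^{1-\alpha}\Lambda(Q)^{\alpha}}\right)}\Phi(Q)^{1-\alpha}\Lambda(Q)^\alpha,$$ where $W_{-1}$ and $W$ denote the lower and the principal branch of the Lambert function respectively, with $W_{-1}(0):=-\infty$.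
   Context: Setting. Let $X$ be a set, $S:X\to X$ a bijection, $\mathcal A$ a $\sigma$-algebra on $X$, $\mathcal A_0$ the $\sigma$-algebra generated by $\bigcup_{i\ge 0}S^{-i}\mathcal A$, $\mathcal B$ the $\sigma$-algebra generated by $\bigcup_{i\in\mathbb Z}S^{-i}\mathcal A$, and $\mathcal A_m:=S^{-m}\mathcal A_0=\{S^{-m}A:A\in\mathcal A_0\}$ for integers $m\le 0$ (so $\mathcal A_0\subset\mathcal A_{-1}\subset\cdots$). Let $\phi_0$ be a finite positive measure on $\mathcal A_0$, and $\Lambda$ a finite positive measure on $\mathcal A_0$ with $\Lambda\circ S^{-1}=\Lambda$ and $\Lambda\ll\phi_0$; let $Z\ge0$ be an $\mathcal A_0$-measurable version of $d\Lambda/d\phi_0$. For $Q\subset X$ let $\mathcal C(Q)$ be the set of all sequences $(A_m)_{m\le0}$ with $A_m\in\mathcal A_m$ for all $m\le 0$ and $Q\subset\bigcup_{m\le0}A_m$. Define $\Phi(Q):=\inf_{(A_m)\in\mathcal C(Q)}\sum_{m\le0}\phi_0(S^mA_m)$. The symbol $\Lambda$ also denotes $\Lambda(Q):=\inf_{(A_m)\in\mathcal C(Q)}\sum_{m\le0}\Lambda(S^mA_m)$, $Q\subset X$; its restriction to $\mathcal B$ is the unique $S$-invariant measure on $\mathcal B$ extending $\Lambda$. Conventions: extended real numbers are used, $0\log0:=0$, $y^x:=e^{x\log y}$ and thus $0^0:=1$, $e^{-\infty}:=0$; $Z^\alpha\log Z:=0$ where $Z=0$ ($\alpha>0$). For $\epsilon>0$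 and $\alpha\in[0,1]$: $\mathcal C^0_\epsilon(Q):=\{(A_m)\in\mathcal C(Q):\sum_{m\le0}\phi_0(S^mA_m)<\Phi(Q)+\epsilon\}$; $\mathcal H^{\alpha,0}(\Lambda,\phi_0)(Q):=\lim_{\epsilon\to0}\inf_{(A_m)\in\mathcal C^0_\epsilon(Q)}\sum_{m\le0}\int_{S^mA_m}Z^\alpha d\phi_0$, which is a finite $S$-invariant measure on $\mathcal B$. For $Q\in\mathcal B$: $\mathcal C^{\alpha}_{1,\epsilon}(Q):=\{(A_m)\in\mathcal C^0_\epsilon(Q):\sum_{m\le0}\int_{S^mA_m}Z^\alpha d\phi_0<\mathcal H^{\alpha,0}(\Lambda,\phi_0)(Q)+\epsilon\}$; for $0<\alpha<1$: $\Psi^{\alpha,\alpha}_1(Q):=\lim_{\epsilon\to0}\inf_{(A_m)\in\mathcal C^{\alpha}_{1,\epsilon}(Q)}\sum_{m\le0}\int_{S^mA_m}Z^\alpha\log Z\,d\phi_0$. Let $\mathcal C^1_\epsilon(Q):=\{(A_m)\in\mathcal C(Q):\sum_{m\le0}\Lambda(S^mA_m)<\Lambda(Q)+\epsilon\}$; $\mathcal C^{0,1}_\epsilon(Q):=\{(A_m)\in\mathcal C^1_\epsilon(Q):\sum_{m\le0}\phi_0(S^mA_m)<\Phi^{\Lambda}(Q)+\epsilon\}$, where $\Phi^{\Lambda}(Q):=\lim_{\epsilon\to0}\inf_{(A_m)\in\mathcal C^1_\epsilon(Q)}\sum_{m\le0}\phi_0(S^mA_m)$ (which equals $\Phi(Q)$);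 $\mathcal H^{\alpha,0,1}(\Lambda,\phi_0)(Q):=\lim_{\epsilon\to0}\inf_{(A_m)\in\mathcal C^{0,1}_\epsilon(Q)}\sum_{m\le0}\int_{S^mA_m}Z^\alpha d\phi_0$ and $\mathcal C^{\alpha,0,1}_\epsilon(Q):=\{(A_m)\in\mathcal C^{0,1}_\epsilon(Q):\sum_{m\le0}\int_{S^mA_m}Z^\alpha d\phi_0<\mathcal H^{\alpha,0,1}(\Lambda,\phi_0)(Q)+\epsilon\}$. For $0<\alpha<1$: $\Xi^{\alpha,\alpha}_1(Q):=\lim_{\epsilon\to0}\sup_{(A_m)\in\mathcal C^{\alpha,0,1}_\epsilon(Q)}\sum_{m\le0}\int_{S^mA_m}Z^\alpha\log Z\,d\phi_0$. The Lambert branches on $[-1/e,0)$ are the solutions $w$ of $we^w=x$ with $w=W(x)\ge-1$ and $w=W_{-1}(x)\le-1$; $W(0)=0$. *)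

(* Defs.v *)
(* MathComp-Analysis *)
From mathcomp Require Import all_boot all_order all_algebra.
From mathcomp Require Import all_classical all_reals all_analysis.
From mathcomp Require Import measurable_realfun.
Set Implicit Arguments.
Unset Strict Implicit.
Unset Printing Implicit Defensive.
Import Order.TTheory GRing.Theory Num.Theory.
Import numFieldNormedType.Exports.

Local Open Scope classical_set_scope.
Local Open Scope ring_scope.
Local Open Scope ereal_scope.

(* The set S^{-i}A for i in Z: a preimage for i >= 0 and, S being bijective,
   an image for i < 0. *)
Definition Spreim (X : Type) (S : X -> X) (i : int) (A : set X) : set X :=
  match i with
  | Posz n => iter n S @^-1` A
  | Negz n => iter n.+1 S @` A
  end.

Definition Sfam (X : Type) (S : X -> X) (i : int) (F : set (set X)) :
  set (set X) := [set Spreim S i A | A in F].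

Definition gen0 (X : Type) (S : X -> X) (F : set (set X)) : set (set X) :=
  \bigcup_(n in [set: nat]) Sfam S n%:Z F.

Definition sigA0 (X : Type) (S : X -> X) (F : set (set X)) : set (set X) :=
  <<s gen0 S F >>.

Definition sigB (X : Type) (S : X -> X) (F : set (set X)) : set (set X) :=
  <<s \bigcup_(i in [set: int]) Sfam S i F >>.

(* X as a measurable space whose measurable sets are those of sigA0 S F *)
Notation A0type S F := (g_sigma_algebraType (gen0 S F)).

(* Families (A_m)_{m <= 0} are indexed by n = - m in nat; sigAm S F n is the
   sigma-algebra S^{-m} A_0 for m = - n. *)
Definition sigAm (X : Type) (S : X -> X) (F : set (set X)) (n : nat) :
  set (set X) := Sfam S (- n%:Z)%R (sigA0 S F).

Definition covers (X : Type) (S : X -> X) (F : set (set X)) (Q : set X) :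
    set (nat -> set X) :=
  [set A | (forall n, sigAm S F n (A n)) /\ Q `<=` \bigcup_n A n].

(* sum over m <= 0 of mu (S^m A_m) *)
Definition cost (R : realType) (X : Type) (S : X -> X) (mu : set X -> \bar R)
  (A : nat -> set X) : \bar R := \sum_(0 <= n <oo) mu (Spreim S n%:Z (A n)).

Definition inf_cost (R : realType) (X : Type) (S : X -> X) (F : set (set X))
    (mu : set X -> \bar R) (Q : set X) : \bar R :=
  ereal_inf (cost S mu @` covers S F Q).

Definition below (R : realType) (X : Type) (C : set (nat -> set X))
    (f : (nat -> set X) -> \bar R) (v : \bar R) (e : R) : set (nat -> set X) :=
  [set A | C A /\ f A < v + e%:E].

Definition lim_inf0 (R : realType) (X : Type) (C : R -> set (nat -> set X))
    (f : (nat -> set X) -> \bar R) : \bar R :=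
  lim (ereal_inf (f @` C e) @[e --> (0%R : R)^'+]).

Definition lim_sup0 (R : realType) (X : Type) (C : R -> set (nat -> set X))
    (f : (nat -> set X) -> \bar R) : \bar R :=
  lim (ereal_sup (f @` C e) @[e --> (0%R : R)^'+]).

Section densities.
Context (R : realType) (X : pointedType) (S : X -> X) (F : set (set X)).
Context (phi0 Lam : {measure set (A0type S F) -> \bar R}).
Context (Z : A0type S F -> \bar R).
Implicit Types (Q : set X) (a e : R).

Definition int_pow a (B : set X) : \bar R := \int[phi0]_(x in B) (Z x `^ a).

(* Since 0 * -oo = 0 in \bar R, the integrand is 0 where Z = 0 if a > 0. *)
Definition int_powlog a (B : set X) : \bar R :=
  \int[phi0]_(x in B) (Z x `^ a * lne (Z x)).

(* Phi(Q) and Lambda(Q) *)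
Definition Phi Q : \bar R := inf_cost S F phi0 Q.
Definition LamX Q : \bar R := inf_cost S F Lam Q.

(* C^0_e(Q) *)
Definition C0 Q e := below (covers S F Q) (cost S phi0) (Phi Q) e.

(* H^{a,0}(Lambda, phi0)(Q) *)
Definition H0 a Q : \bar R := lim_inf0 (C0 Q) (cost S (int_pow a)).

(* C^a_{1,e}(Q) *)
Definition Ca1 a Q e := below (C0 Q e) (cost S (int_pow a)) (H0 a Q) e.

(* Psi^{a,a}_1(Q) *)
Definition Psi1 a Q : \bar R := lim_inf0 (Ca1 a Q) (cost S (int_powlog a)).

(* C^1_e(Q) *)
Definition C1 Q e := below (covers S F Q) (cost S Lam) (LamX Q) e.

(* Phi^Lambda(Q) *)
Definition PhiL Q : \bar R := lim_inf0 (C1 Q) (cost S phi0).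

(* C^{0,1}_e(Q) *)
Definition C01 Q e := below (C1 Q e) (cost S phi0) (PhiL Q) e.

(* H^{a,0,1}(Lambda, phi0)(Q) *)
Definition H01 a Q : \bar R := lim_inf0 (C01 Q) (cost S (int_pow a)).

(* C^{a,0,1}_e(Q) *)
Definition Ca01 a Q e := below (C01 Q e) (cost S (int_pow a)) (H01 a Q) e.

(* Xi^{a,a}_1(Q) *)
Definition Xi1 a Q : \bar R := lim_sup0 (Ca01 a Q) (cost S (int_powlog a)).

End densities.

(* The Lambert branches are meaningful for -1/e <= x <= 0 only; the values
   selected by xget outside this range are irrelevant. *)
Definition lambertW (R : realType) (x : R) : R :=
  xget 0%R [set w : R | (-1 <= w)%R /\ (w * expR w = x)%R].

(* W_{-1}, with W_{-1}(0) = -oo *)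
Definition lambertWm1 (R : realType) (x : R) : \bar R :=
  if x == 0%R then -oo
  else (xget (-1)%R [set w : R | (w <= -1)%R /\ (w * expR w = x)%R])%:E.

(* Main.v *)
(* For a cover (A_m) put f(t) = sum_m int_(S^m A_m) Z^t dphi0, so that f(0) and
   f(1) are its costs for phi0 and Lambda and f'(alpha) its cost for
   Z^alpha log Z.  Since f is log-convex, the tangent of log f at alpha gives
   f(alpha)/alpha log(f(alpha)/f(0)) <= f'(alpha)
     <= f(alpha)/(1 - alpha) log(f(1)/f(alpha)).
   Passing to the limit along the covers defining Psi (left inequality) and Xi
   (right inequality) gives (i), provided that H^(alpha,0,1) = H^(alpha,0) and
   Phi^Lambda = Phi; then also Psi <= Xi, and (ii) is (i) read as
   w e^w <= x <= 0 with w = log(H / (Phi^(1-alpha) Lambda^alpha)).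

   These two equalities mean that one cover can be almost optimal for several
   costs at once.  For a finite measure phi, let Phi be the infimum of the costs
   of the covers.  It is additive on A_0 and Phi(S Q) <= Phi(Q), so comparing a
   set and its complement inside X shows that Phi is S-invariant on A_0.
   Intersecting a cover that is good for phi with one that is good for an
   invariant measure Lambda yields countably many pieces, each in some
   S^N A_0.  Trimmed to such a piece, a disjoint cover has Lambda-cost at most
   the measure of the piece, so it can be chosen almost optimal for phi; by
   additivity the sum of the costs over all pieces is controlled. *)
From HB Require Import structures.
Require Import Defs.
From mathcomp Require Import all_boot all_order all_algebra.
From mathcomp Require Import all_classical all_reals all_analysis.
From mathcomp Require Import measurable_realfun zify ring lra.
Set Implicit Arguments.
Unset Strict Implicit.
Unset Printing Implicit Defensive.
Import Order.TTheory GRing.Theory Num.Theory.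
Import numFieldNormedType.Exports.

Local Open Scope classical_set_scope.
Local Open Scope ring_scope.
Local Open Scope ereal_scope.

(** * Shifted covers, their infimal cost, and the cutting of covers into pieces *)

Lemma iter_surj (T : Type) (S : T -> T) n y :
  bijective S -> exists x, iter n S x = y.
Proof.
case=> g _ gK; elim: n y => [|n IH] y; first by exists y.
by have [x xE] := IH (g y); exists x; rewrite /= xE gK.
Qed.

Lemma iter_inj (T : Type) (S : T -> T) n : bijective S -> injective (iter n S).
Proof. by move=> bS; elim: n => [|n IH] x y //= /(bij_inj bS); exact: IH. Qed.

Section shift_covers.
Context d (T : measurableType d) (R : realType) (S : T -> T).
Hypothesis bijS : bijective S.
Hypothesis mS : measurable_fun [set: T] S.
Implicit Types (Q : set T) (D : nat -> set T) (mu : {measure set T -> \bar R}).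

Lemma measurable_iter n A : measurable A -> measurable (iter n S @^-1` A).
Proof.
move=> mA; elim: n => [//|n IH].
rewrite (_ : iter n.+1 S @^-1` A = S @^-1` (iter n S @^-1` A)).
  by rewrite -[X in measurable X]setTI; exact: mS.
by apply/seteqP; split => x /=; rewrite -iterS iterSr.
Qed.

(* [D n] stands for the set S^m A_m in A_0, where m = - n, of a cover (A_m). *)
Definition shift_cover Q : set (nat -> set T) :=
  [set D | (forall n, measurable (D n)) /\
           Q `<=` \bigcup_n (iter n S @` D n)].

Definition shift_inf mu Q : \bar R :=
  ereal_inf [set \sum_(0 <= n <oo) mu (D n) | D in shift_cover Q].

Lemma shift_inf_ge0 mu Q : 0 <= shift_inf mu Q.
Proof. by apply: le_ereal_inf_tmp => _ [D _ <-]; exact: nneseries_ge0. Qed.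

Lemma shift_inf_le mu Q D :
  shift_cover Q D -> shift_inf mu Q <= \sum_(0 <= n <oo) mu (D n).
Proof. by move=> cD; apply: ereal_inf_lbound; exists D. Qed.

Lemma le_shift_inf mu Q1 Q2 : Q1 `<=` Q2 -> shift_inf mu Q1 <= shift_inf mu Q2.
Proof.
move=> Q12; apply: le_ereal_inf_tmp => _ [D [mD QD] <-].
by apply: shift_inf_le; split => //; exact: subset_trans QD.
Qed.

Lemma shift_inf_measurable mu A : measurable A -> shift_inf mu A <= mu A.
Proof.
move=> mA; pose D n := if n is 0%N then A else set0.
have <- : \sum_(0 <= n <oo) mu (D n) = mu A.
  rewrite nneseries_recl// eseries0 ?adde0// => -[|n] //= _ _.
apply: shift_inf_le; split => [|x Ax]; first by case=> [|n]; rewrite /D.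
by exists 0%N => //=; exists x.
Qed.

(** Moving the set at index n to index n + N, with empty sets below N, shifts the covered set and
    leaves the cost unchanged. *)
Lemma shift_inf_shift mu N Q : shift_inf mu (iter N S @` Q) <= shift_inf mu Q.
Proof.
apply: le_ereal_inf_tmp => _ [D [mD QD] <-].
pose D' n := if (n < N)%N then set0 else D (n - N)%N.
have -> : \sum_(0 <= n <oo) mu (D n) = \sum_(0 <= n <oo) mu (D' n).
  rewrite [RHS](nneseries_split 0 N)//= add0n big1_seq ?add0e; last first.
    by move=> n; rewrite /D' mem_index_iota /= => ->; rewrite measure0.
  rewrite -(nneseries_addn (f := fun n => mu (D' n)) N)//.
  by apply: eq_eseriesr => n _; rewrite /D' ltnNge leq_addl /= addnK.
apply: shift_inf_le; split => [n|_ [x Qx <-]].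
  by rewrite /D'; case: ifP.
have [n _ [y Dy yx]] := QD x Qx.
exists (n + N)%N => //; exists y; first by rewrite /D' ltnNge leq_addl /= addnK.
by rewrite addnC iterD yx.
Qed.

Lemma shift_inf_sigma_subadditive mu Q (P : nat -> set T) :
  Q `<=` \bigcup_i P i ->
  shift_inf mu Q <= \sum_(0 <= i <oo) shift_inf mu (P i).
Proof.
move=> QP; have [[i ioo]|] := pselect (exists i, shift_inf mu (P i) = +oo).
  rewrite (eseries_pinfty _ _ ioo) ?leey// => n _.
  by rewrite -ltNye (lt_le_trans _ (shift_inf_ge0 _ _)).
rewrite -forallNE => Poo; apply/lee_addgt0Pr => e e0.
apply: (le_trans _ (epsilon_trick _ _ (ltW e0))); last first.
  by move=> n; exact: shift_inf_ge0.
have /choice[D DP] : forall i, exists D, shift_cover (P i) D /\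
    \sum_(0 <= n <oo) mu (D n) <= shift_inf mu (P i) + (e / (2 ^ i.+1)%:R)%:E.
  move=> i; have e2 : (0 < e / (2 ^ i.+1)%:R :> R)%R by rewrite divr_gt0.
  have fi : shift_inf mu (P i) \is a fin_num.
    rewrite ge0_fin_numE ?shift_inf_ge0// ltey; exact/eqP.
  have [_ [D cD <-] /ltW lD] := lb_ereal_inf_adherent e2 fi.
  by exists D.
(* The covers are merged index by index, so that there is again one measurable set for each n. *)
pose C n := \bigcup_i D i n.
apply: (@le_trans _ _ (\sum_(0 <= n <oo) mu (C n))).
  apply: shift_inf_le; split => [n|x Qx].
    by apply: bigcup_measurable => i _; exact: (DP i).1.1.
  have [i _ Pix] := QP x Qx.
  have [n _ [y Dy yx]] := (DP i).1.2 x Pix.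
  by exists n => //; exists y => //; exists i.
apply: (@le_trans _ _ (\sum_(0 <= n <oo) \sum_(0 <= i <oo) mu (D i n))).
  apply: lee_nneseries => // n _.
  apply: measure_sigma_subadditive => [i||//]; first exact: (DP i).1.1.
  by apply: bigcup_measurable => i _; exact: (DP i).1.1.
rewrite nneseries_interchange//; apply: lee_nneseries => [i _ _|i _].
  exact: nneseries_ge0.
exact: (DP i).2.
Qed.

Lemma shift_inf_subadditive mu Q Q1 Q2 : Q `<=` Q1 `|` Q2 ->
  shift_inf mu Q <= shift_inf mu Q1 + shift_inf mu Q2.
Proof.
move=> QQ; have /shift_inf_sigma_subadditive : Q `<=` \bigcup_i bigcup2 Q1 Q2 i.
  by rewrite bigcup2E.
move=> /(_ mu)/le_trans; apply.
rewrite nneseries_recl//; last by move=> *; exact: shift_inf_ge0.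
rewrite leeD2l// (nneseries_split 1 1); last first.
  by move=> *; exact: shift_inf_ge0.
rewrite big_nat1 -[leRHS]adde0 leeD2l// eseries0// => -[//|[//|n]] _ _ /=.
apply/eqP; rewrite eq_le shift_inf_ge0 andbT.
by rewrite (le_trans (shift_inf_measurable _ _))// measure0.
Qed.

(** Any cover of the union can be cut: because A and B are measurable, so are their preimages under
    [iter n S], and the traces of [D n] on these two disjoint preimages cover A and B separately. *)
Lemma shift_inf_superadditive mu A B : measurable A -> measurable B ->
  A `&` B = set0 ->
  shift_inf mu A + shift_inf mu B <= shift_inf mu (A `|` B).
Proof.
move=> mA mB AB0; apply: le_ereal_inf_tmp => _ [D [mD QD] <-].
pose E A n := D n `&` iter n S @^-1` A.
have mE C n : measurable C -> measurable (E C n).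
  by move=> mC; apply: measurableI => //; exact: measurable_iter.
have cE C : measurable C -> C `<=` A `|` B -> shift_cover C (E C).
  move=> mC CAB; split => [n|x Cx]; first exact: mE.
  have [n _ [y Dy yx]] := QD x (CAB x Cx).
  by exists n => //; exists y => //; split => //=; rewrite yx.
apply: le_trans.
  apply: leeD; [apply: (shift_inf_le mu (cE A mA _))
               |apply: (shift_inf_le mu (cE B mB _))].
    exact: subsetUl.
  exact: subsetUr.
rewrite -nneseriesD//; apply: lee_nneseries => [n _|n _].
  by rewrite adde_ge0.
rewrite -measureU; [|exact: mE|exact: mE|].
  apply: le_measure; rewrite ?inE//; last by move=> x [] [].
  by apply: measurableU; exact: mE.
rewrite -subset0 => x [[_ /= Ax] [_ /= Bx]].
by have : (A `&` B) (iter n S x) by []; rewrite AB0.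
Qed.

Lemma shift_inf_invariant mu A : mu setT < +oo -> measurable A ->
  shift_inf mu (S @^-1` A) = shift_inf mu A.
Proof.
move=> muT mA.
have mSA B : measurable B -> measurable (S @^-1` B).
  by move=> mB; exact: (measurable_iter 1).
have fin B : shift_inf mu B \is a fin_num.
  rewrite ge0_fin_numE ?shift_inf_ge0//.
  apply: le_lt_trans muT; apply: (le_trans (le_shift_inf mu (subsetT B))).
  exact: shift_inf_measurable.
(* S maps the preimage of B onto B, and shifting does not increase the infimal cost. *)
have down B : shift_inf mu B <= shift_inf mu (S @^-1` B).
  apply: le_trans (shift_inf_shift mu 1 _); apply: le_shift_inf => x Bx.
  by have [y yx] := iter_surj 1 x bijS; exists y => //=; rewrite -/(iter 1 S y) yx.
apply/eqP; rewrite eq_le down andbT.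
(* [down] holds for A and for its complement; this reverse inequality between the sums, all terms
   being finite, forces equality in both. *)
have : shift_inf mu (S @^-1` A) + shift_inf mu (S @^-1` (~` A)) <=
       shift_inf mu A + shift_inf mu (~` A).
  apply: le_trans (shift_inf_superadditive mu _ _ _) _; first exact: mSA.
  - by apply: mSA; exact: measurableC.
  - by rewrite -preimage_setI setICr preimage_set0.
  - by apply: shift_inf_subadditive => x _; exact: lem.
have := down (~` A).
rewrite -(fineK (fin A)) -(fineK (fin (~` A))).
rewrite -(fineK (fin (S @^-1` A))) -(fineK (fin (S @^-1` (~` A)))).
rewrite -!EFinD !lee_fin; lra.
Qed.

(* The set S^(-N) (S^m A `&` S^k B) with N = max m k. *)
Definition shift_piece m A k B : set T :=
  iter (maxn m k - m) S @^-1` A `&` iter (maxn m k - k) S @^-1` B.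

Lemma measurable_shift_piece m A k B : measurable A -> measurable B ->
  measurable (shift_piece m A k B).
Proof. by move=> mA mB; apply: measurableI; exact: measurable_iter. Qed.

Lemma shift_pieceC m A k B : shift_piece m A k B = shift_piece k B m A.
Proof. by rewrite /shift_piece maxnC setIC. Qed.

Definition shift_disjoint D := forall N m k, (m < k <= N)%N ->
  iter (N - m) S @^-1` D m `&` iter (N - k) S @^-1` D k = set0.

Definition disjointify D n :=
  D n `\` \bigcup_(k in [set k | (k < n)%N]) (iter (n - k) S @^-1` D k).

Lemma measurable_disjointify D n :
  (forall n, measurable (D n)) -> measurable (disjointify D n).
Proof.
move=> mD; apply: measurableD => //; apply: bigcup_measurable => k _.
exact: measurable_iter.
Qed.

Lemma shift_disjoint_disjointify D : shift_disjoint (disjointify D).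
Proof.
move=> N m k /andP[mk kN]; rewrite -subset0 => x [[/= Dx _] [_ /= nDx]].
apply: nDx; exists m => //=; rewrite -iterD.
by rewrite (_ : (k - m + (N - k) = N - m)%N) //; lia.
Qed.

(** Strong induction on the index covering a point: whatever is removed at level n is already
    covered at some k < n. *)
Lemma shift_cover_disjointify Q D :
  shift_cover Q D -> shift_cover Q (disjointify D).
Proof.
move=> [mD QD]; split => [n|q Qq]; first exact: measurable_disjointify.
have [n _] := QD q Qq; elim/ltn_ind: n => n IH [x Dx xq].
have [[k /= kn Dk]|nD] := pselect ((\bigcup_(k in [set k | (k < n)%N])
    (iter (n - k) S @^-1` D k)) x); last by exists n => //; exists x.
apply: (IH k kn); exists (iter (n - k) S x) => //.
by rewrite -iterD subnKC// ltnW.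
Qed.

(* Only finite superadditivity is required of [mu], because it is applied both
   to an invariant measure and to the restriction of [shift_inf]. *)
Lemma shift_piece_superadditive (mu : set T -> \bar R) :
  (forall A, 0 <= mu A) ->
  (forall A B, measurable A -> measurable B -> A `<=` B -> mu A <= mu B) ->
  (forall A B, measurable A -> measurable B -> A `&` B = set0 ->
    mu A + mu B <= mu (A `|` B)) ->
  (forall A, measurable A -> mu (S @^-1` A) = mu A) ->
  forall m A B, measurable A -> (forall k, measurable (B k)) ->
  shift_disjoint B ->
  \sum_(0 <= k <oo) mu (shift_piece m A k (B k)) <= mu A.
Proof.
move=> mu0 mu_le mu_add mu_inv m A B mA mB dB.
have mu_iter n C : measurable C -> mu (iter n S @^-1` C) = mu C.
  move=> mC; elim: n => [//|n IH]; rewrite -[RHS]IH -[RHS]mu_inv.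
    by congr mu; apply/seteqP; split => x; rewrite /preimage /mkset iterSr.
  exact: measurable_iter.
apply: lime_le.
  by apply: is_cvg_nneseries => n _ _; exact: mu0.
(* The first K pieces live at different levels. Pulled back to level N they become disjoint subsets
   of one preimage of A, and invariance preserves all values. *)
apply: nearW => K; pose N := maxn m K.
pose E k := iter (N - m) S @^-1` A `&` iter (N - k) S @^-1` B k.
have mE k : measurable (E k) by apply: measurableI; exact: measurable_iter.
have piece k : (k < K)%N -> mu (shift_piece m A k (B k)) = mu (E k).
  move=> kK; rewrite -(mu_iter (N - maxn m k)%N); last first.
    exact: measurable_shift_piece.
  congr mu; rewrite /shift_piece /E preimage_setI.
  congr (_ `&` _); apply/seteqP; split => x /=; rewrite -iterD.
  - by rewrite (_ : (maxn m k - m + (N - maxn m k) = N - m)%N)// /N; lia.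
  - by rewrite (_ : (maxn m k - m + (N - maxn m k) = N - m)%N)// /N; lia.
  - by rewrite (_ : (maxn m k - k + (N - maxn m k) = N - k)%N)// /N; lia.
  - by rewrite (_ : (maxn m k - k + (N - maxn m k) = N - k)%N)// /N; lia.
rewrite (eq_big_nat _ _ (F2 := fun k => mu (E k))); last first.
  by move=> k /andP[_]; exact: piece.
have sum_le n : (n <= K)%N ->
    \sum_(0 <= k < n) mu (E k) <= mu (\big[setU/set0]_(0 <= k < n) E k).
  elim: n => [|n IH] nK; first by rewrite !big_nil.
  rewrite !big_nat_recr//=; apply: (le_trans _ (mu_add _ _ _ _ _)) => //.
  - by apply: leeD2r; apply: IH; exact: ltnW.
  - by apply: bigsetU_measurable => k _.
  - rewrite -subset0 => x [].
    rewrite big_mkord -bigcup_mkord => -[k /= kn [_ Bk]] [_ Bn].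
    suff : (iter (N - k) S @^-1` B k `&` iter (N - n) S @^-1` B n) x.
      by rewrite dB // kn /= /N; lia.
    by [].
apply: (le_trans (sum_le K (leqnn K))).
rewrite -[leRHS](mu_iter (N - m)%N A mA); apply: mu_le.
- by apply: bigsetU_measurable => k _.
- exact: measurable_iter.
- by rewrite big_mkord -bigcup_mkord => x [k _ []].
Qed.

Lemma shift_inf_add_measurable (phi Lam psi : {measure set T -> \bar R}) (D : set T) :
  (forall A, measurable A -> Lam (S @^-1` A) = Lam A) ->
  (forall A, measurable A -> psi A = phi A + Lam A) ->
  measurable D -> shift_inf psi D <= shift_inf phi D + Lam D.
Proof.
move=> invL psiE mD; have [->|LD] := eqVneq (Lam D) +oo.
  rewrite addey ?leey// gt_eqF//.
  by rewrite (lt_le_trans _ (shift_inf_ge0 _ _))// ltNy0.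
have LDf : Lam D \is a fin_num by rewrite ge0_fin_numE// ltey.
rewrite -leeBlDr//; apply: le_ereal_inf_tmp => _ [C cC <-].
rewrite leeBlDr//.
have mC := cC.1.
(* With m = 0 the piece lives at level n: it is the part of the n-th disjointified set that
   [iter n S] sends into D. *)
pose C' n := shift_piece 0 D n (disjointify C n).
have mC' n : measurable (C' n).
  by apply: measurable_shift_piece => //; exact: measurable_disjointify.
have cC' : shift_cover D C'.
  split => // x Dx.
  have [n _ [y Cy yx]] := (shift_cover_disjointify cC).2 x Dx.
  exists n => //; exists y => //; rewrite /C' /shift_piece max0n subn0 subnn.
  by split => //=; rewrite yx.
apply: (le_trans (shift_inf_le psi cC')).
under eq_eseriesr do rewrite psiE//.
rewrite nneseriesD//; apply: leeD.
  apply: lee_nneseries => // n _; apply: le_measure; rewrite ?inE//.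
  by move=> x; rewrite /C' /shift_piece max0n subnn => -[_ []].
apply: shift_piece_superadditive => //.
- by move=> A B mA mB; apply: le_measure; rewrite inE.
- by move=> A B mA mB AB; rewrite measureU.
- by move=> n; exact: measurable_disjointify.
- exact: shift_disjoint_disjointify.
Qed.

(** On each piece P m k the previous lemma separates the two measures. Summing the phi part over k
    recovers at most the cost of the m-th set of the first cover; summing the Lam part over m
    recovers at most that of the k-th set of the second. *)
Lemma shift_inf_add_le (phi Lam psi : {measure set T -> \bar R}) Q A B :
  phi setT < +oo ->
  (forall C, measurable C -> Lam (S @^-1` C) = Lam C) ->
  (forall C, measurable C -> psi C = phi C + Lam C) ->
  shift_cover Q A -> shift_cover Q B ->
  shift_inf psi Q <=
    \sum_(0 <= n <oo) phi (A n) + \sum_(0 <= n <oo) Lam (B n).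
Proof.
move=> phiT invL psiE cA cB.
have [mA QA] := shift_cover_disjointify cA.
have [mB QB] := shift_cover_disjointify cB.
set A' := disjointify A in mA QA; set B' := disjointify B in mB QB.
pose P m k := shift_piece m (A' m) k (B' k).
have mP m k : measurable (P m k) by exact: measurable_shift_piece.
have QP : Q `<=` \bigcup_m \bigcup_k (iter (maxn m k) S @` P m k).
  move=> q Qq; have [m _ [a Aa aq]] := QA q Qq; have [k _ [b Bb bq]] := QB q Qq.
  exists m => //; exists k => //.
  have [y yq] := iter_surj (maxn m k) q bijS; exists y => //; split => /=.
  - rewrite (_ : iter _ S y = a)//; apply: (iter_inj (n := m) bijS).
    by rewrite -iterD subnKC ?leq_maxl// yq aq.
  - rewrite (_ : iter _ S y = b)//; apply: (iter_inj (n := k) bijS).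
    by rewrite -iterD subnKC ?leq_maxr// yq bq.
apply: (le_trans (shift_inf_sigma_subadditive psi QP)).
apply: (@le_trans _ _ (\sum_(0 <= m <oo) \sum_(0 <= k <oo)
    (shift_inf phi (P m k) + Lam (P m k)))).
  apply: lee_nneseries => [m _ _|m _]; first exact: shift_inf_ge0.
  apply: le_trans.
    exact: (@shift_inf_sigma_subadditive _ _ (fun k => iter (maxn m k) S @` P m k)).
  apply: lee_nneseries => [k _ _|k _]; first exact: shift_inf_ge0.
  apply: (le_trans (shift_inf_shift _ _ _)).
  exact: shift_inf_add_measurable.
under eq_eseriesr => m _.
  rewrite nneseriesD; [|by move=> *; exact: shift_inf_ge0|by []].
  over.
rewrite nneseriesD; last 2 first.
- by move=> *; apply: nneseries_ge0 => *; exact: shift_inf_ge0.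
- by move=> *; exact: nneseries_ge0.
have disj_le (mu : {measure set T -> \bar R}) D n : (forall n, measurable (D n)) ->
    mu (disjointify D n) <= mu (D n).
  move=> mD; apply: le_measure; rewrite ?inE//; first exact: measurable_disjointify.
  by move=> x [].
apply: leeD.
  apply: lee_nneseries => [m _ _|m _].
    by apply: nneseries_ge0 => *; exact: shift_inf_ge0.
  (* phi is not assumed invariant, but its infimal cost is invariant on measurable sets;
     superadditivity over the pieces is therefore applied to [shift_inf phi]. *)
  apply: (@le_trans _ _ (shift_inf phi (A' m))).
    apply: (@shift_piece_superadditive (shift_inf phi)) => //.
    - exact: shift_inf_ge0.
    - by move=> C D _ _; exact: le_shift_inf.
    - exact: shift_inf_superadditive.
    - by move=> C; exact: shift_inf_invariant.
    - exact: shift_disjoint_disjointify.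
  by apply: (le_trans (shift_inf_measurable _ (mA m))); exact: (disj_le _ _ _ cA.1).
rewrite nneseries_interchange//; apply: lee_nneseries => [k _ _|k _].
  exact: nneseries_ge0.
apply: (@le_trans _ _ (Lam (B' k))); last exact: (disj_le _ _ _ cB.1).
under eq_eseriesr do rewrite /P shift_pieceC.
apply: shift_piece_superadditive => //.
- by move=> C D mC mD; apply: le_measure; rewrite inE.
- by move=> C D mC mD CD; rewrite measureU.
- exact: shift_disjoint_disjointify.
Qed.

End shift_covers.

(** * Correspondence between covers (A_m) and families of sets S^m A_m *)

Section shift_pullback.
Context (X : pointedType) (S : X -> X) (F : set (set X)).
Local Notation T := (A0type S F).

Lemma measurable_shift : measurable_fun [set: T] (S : T -> T).
Proof.
apply: (@measurability _ _ T T setT S (gen0 S F) erefl) => _ [_ [n _ [A FA <-]] <-].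
rewrite setTI; apply: sub_sigma_algebra; exists n.+1 => //; exists A => //.
by apply/seteqP; split => x /=; rewrite -iterS iterSr.
Qed.

Lemma Spreim_negE n (D : set X) : Spreim S (- n%:Z)%R D = iter n S @` D.
Proof.
case: n => [|n] //=; apply/seteqP; split => [x Dx|_ [x Dx <-]//].
by exists x.
Qed.

Hypothesis bijS : bijective S.

Lemma covers_shift_cover Q A : covers S F Q A ->
  shift_cover (S : T -> T) Q (fun n => Spreim S n%:Z (A n)).
Proof.
move=> [sA QA]; split => [n|q Qq].
  have [D mD <-] := sA n; rewrite Spreim_negE /=.
  rewrite (_ : _ @^-1` _ = D)//; apply/seteqP; split => [x [y Dy]|x Dx].
    by move/(@iter_inj _ _ n bijS) => <-.
  by exists x.
have [n _ Aq] := QA q Qq; have [x xq] := iter_surj n q bijS.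
by exists n => //; exists x => //=; rewrite xq.
Qed.

Lemma shift_cover_covers Q D : shift_cover (S : T -> T) Q D ->
  exists2 A, covers S F Q A & forall n, Spreim S n%:Z (A n) = D n.
Proof.
move=> [mD QD]; exists (fun n => iter n S @` D n).
  by split => // n; exists (D n); [exact: mD|exact: Spreim_negE].
move=> n; apply/seteqP; split => [x [y Dy]|x Dx] /=.
  by move/(@iter_inj _ _ n bijS) => <-.
by exists x.
Qed.

End shift_pullback.

(** * Limits of infima and suprema over families of covers that shrink with the tolerance *)

Section limits.
Context (R : realType) (X : Type).
Variables (C : R -> set (nat -> set X)) (f : (nat -> set X) -> \bar R).
Hypothesis C_mono : forall e1 e2, (e1 <= e2)%R -> C e1 `<=` C e2.

(** As e decreases the family C e shrinks and the infimum grows, so the right limit at 0 exists and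
    is a supremum. *)
Lemma lim_inf0E :
  lim_inf0 C f = ereal_sup [set ereal_inf (f @` C e) | e in [set e | (0 < e)%R]].
Proof.
apply/cvg_lim => //.
have -> : [set e : R | (0 < e)%R] = [set` Interval (BRight 0%R) (BInfty R false)].
  by apply/seteqP; split => x /=; rewrite in_itv /= andbT.
apply: nonincreasing_at_right_cvge => // a b _ _ ab.
by apply: le_ereal_inf => _ [A CA <-]; exists A => //; exact: C_mono CA.
Qed.

Lemma lim_sup0E :
  lim_sup0 C f = ereal_inf [set ereal_sup (f @` C e) | e in [set e | (0 < e)%R]].
Proof.
apply/cvg_lim => //.
have -> : [set e : R | (0 < e)%R] = [set` Interval (BRight 0%R) (BInfty R false)].
  by apply/seteqP; split => x /=; rewrite in_itv /= andbT.
apply: nondecreasing_at_right_cvge => // a b _ _ ab.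
by apply: le_ereal_sup => _ [A CA <-]; exists A => //; exact: C_mono CA.
Qed.

Lemma lim_inf0_ge e v : (0 < e)%R -> (forall A, C e A -> v <= f A) ->
  v <= lim_inf0 C f.
Proof.
move=> e0 vf; rewrite lim_inf0E.
apply: (@le_trans _ _ (ereal_inf (f @` C e))).
  by apply: le_ereal_inf_tmp => _ [A CA <-]; exact: vf.
by apply: ereal_sup_ubound; exists e.
Qed.

Lemma lim_inf0_le v :
  (forall e, (0 < e)%R -> exists2 A, C e A & f A <= v) -> lim_inf0 C f <= v.
Proof.
move=> fv; rewrite lim_inf0E; apply: ge_ereal_sup => _ [e /= e0 <-].
have [A CA Av] := fv e e0; apply: le_trans Av.
by apply: ereal_inf_lbound; exists A.
Qed.

Lemma lim_inf0_lt v : lim_inf0 C f < v ->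
  forall e, (0 < e)%R -> exists2 A, C e A & f A < v.
Proof.
move=> fv e e0; have : ereal_inf (f @` C e) < v.
  apply: le_lt_trans fv; rewrite lim_inf0E.
  by apply: ereal_sup_ubound; exists e.
by case/ereal_inf_lt => _ [A CA <-] ?; exists A.
Qed.

Lemma lim_inf0_gt v : v < lim_inf0 C f ->
  exists2 e, (0 < e)%R & forall A, C e A -> v < f A.
Proof.
rewrite lim_inf0E => /ereal_sup_gt[_ [e /= e0 <-]] ve; exists e => // A CA.
by apply: (lt_le_trans ve); apply: ereal_inf_lbound; exists A.
Qed.

Lemma lim_sup0_le e v : (0 < e)%R -> (forall A, C e A -> f A <= v) ->
  lim_sup0 C f <= v.
Proof.
move=> e0 fv; rewrite lim_sup0E.
apply: (@le_trans _ _ (ereal_sup (f @` C e))).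
  by apply: ereal_inf_lbound; exists e.
by apply: ge_ereal_sup => _ [A CA <-]; exact: fv.
Qed.

End limits.

Lemma lim_inf0_le_lim_sup0 (R : realType) (X : Type)
    (C C' : R -> set (nat -> set X)) (f : (nat -> set X) -> \bar R) :
  (forall e1 e2, (e1 <= e2)%R -> C e1 `<=` C e2) ->
  (forall e1 e2, (e1 <= e2)%R -> C' e1 `<=` C' e2) ->
  (forall e, (0 < e)%R -> C' e `<=` C e) ->
  (forall e, (0 < e)%R -> exists A, C' e A) ->
  lim_inf0 C f <= lim_sup0 C' f.
Proof.
move=> mC mC' CC' C'0; rewrite lim_inf0E// lim_sup0E//.
apply: ge_ereal_sup => _ [e /= e0 <-]; apply: le_ereal_inf_tmp => _ [e' /= e'0 <-].
(* A cover admissible at the smaller tolerance lies in both families, so its value separates the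
   infimum from the supremum. *)
have m0 : (0 < Num.min e e')%R by rewrite lt_min e0.
have [A CA] := C'0 _ m0; apply: (@le_trans _ _ (f A)).
  apply: ereal_inf_lbound; exists A => //; apply: (mC (Num.min e e')).
    by rewrite ge_min lexx.
  exact: CC'.
apply: ereal_sup_ubound; exists A => //; apply: (mC' (Num.min e e')) => //.
by rewrite ge_min lexx orbT.
Qed.

Lemma below_mono (R : realType) (X : Type) (C C' : set (nat -> set X))
    (f : (nat -> set X) -> \bar R) v (e1 e2 : R) :
  C `<=` C' -> (e1 <= e2)%R -> below C f v e1 `<=` below C' f v e2.
Proof.
move=> CC' e12 A [CA fA]; split; first exact: CC'.
by apply: (lt_le_trans fA); rewrite leeD2l// lee_fin.
Qed.

(** * Extended-real series compared with convergent real series *)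

Section real_series.
Context (R : realType).
Implicit Types (u v g p : nat -> R) (l a : R).

Lemma nneseries_cvg_fine g : (forall n, (0 <= g n)%R) ->
  \sum_(0 <= n <oo) (g n)%:E \is a fin_num ->
  series g @ \oo --> fine (\sum_(0 <= n <oo) (g n)%:E).
Proof.
move=> g0 gfin; have -> : series g = fine \o (fun n => \sum_(0 <= k < n) (g k)%:E).
  by apply/funext => n; rewrite /= sumEFin.
apply: fine_cvg; rewrite fineK//; apply: is_cvg_nneseries => n _ _.
by rewrite lee_fin.
Qed.

(** The terms u need not have a sign, so their series is split as (u - v) + v: the first part is
    nonnegative and converges, possibly to +oo, the second converges to a real. *)
Lemma eseries_cvg_dominated u v l : (forall n, (v n <= u n)%R) ->
  series v @ \oo --> l ->
  exists2 r, 0 <= r & \sum_(0 <= k < n) (u k)%:E @[n --> \oo] --> r + l%:E.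
Proof.
move=> vu vl; pose r := \sum_(0 <= n <oo) (u n - v n)%:E.
have r0 n : 0 <= (u n - v n)%:E by rewrite lee_fin subr_ge0.
exists r; first exact: nneseries_ge0.
have -> : (fun n => \sum_(0 <= k < n) (u k)%:E) =
    (fun n => \sum_(0 <= k < n) (u k - v k)%:E) \+ (EFin \o series v).
  apply/funext => n /=; rewrite !sumEFin -EFinD -big_split /=.
  by congr (_%:E); apply: eq_bigr => k _; rewrite subrK.
apply: cvgeD; first by rewrite fin_num_adde_defl.
  by apply: is_cvg_nneseries => n _ _.
by apply: cvg_EFin => //; exact: nearW.
Qed.

Lemma eseries_ge u v l : (forall n, (v n <= u n)%R) -> series v @ \oo --> l ->
  l%:E <= \sum_(0 <= n <oo) (u n)%:E.
Proof.
move=> vu /(eseries_cvg_dominated vu)[r r0 /cvg_lim ->//].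
by rewrite leeDr.
Qed.

Lemma eseries_le u v l : (forall n, (u n <= v n)%R) -> series v @ \oo --> l ->
  \sum_(0 <= n <oo) (u n)%:E <= l%:E.
Proof.
move=> uv /cvgN vl.
have vl' : series (\- v)%R @ \oo --> (- l)%R.
  by rewrite (_ : series _ = - series v)%R// /series; apply/funext => n; rewrite /= sumrN.
have [r r0] := eseries_cvg_dominated (u := (\- u)%R) (v := (\- v)%R)
  (fun n => (ltac:(by rewrite lerN2) : (- v n <= - u n)%R)) vl'.
move=> /cvgeN; rewrite (_ : (fun n => _) = (fun n => \sum_(0 <= k < n) (u k)%:E)).
  by move/cvg_lim => ->//; rewrite oppeD ?fin_num_adde_defl// EFinN oppeK geeDr// oppe_le0.
by apply/funext => n; rewrite !sumEFin -EFinN sumrN opprK.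
Qed.

Lemma cvg_series_lin g p (a b lg lp : R) :
  series g @ \oo --> lg -> series p @ \oo --> lp ->
  series (fun n => a * g n + b * p n)%R @ \oo --> (a * lg + b * lp)%R.
Proof.
move=> gl pl; have -> : series (fun n => a * g n + b * p n)%R =
    (fun n => a * series g n + b * series p n)%R.
  by apply/funext => n; rewrite /series /= big_split /= !mulr_sumr.
by apply: cvgD; exact: cvgMr.
Qed.

End real_series.

(** * Pointwise tangent inequalities for z^alpha log z *)

Section tangent.
Context (R : realType) (alpha : R).
Hypothesis alpha01 : (0 < alpha < 1)%R.
Local Open Scope ring_scope.

(** This is ln(1 + t) <= t at t = x/y - 1, multiplied by y. *)
Lemma ln_div_le (x y : R) : 0 < x -> 0 < y -> y * (ln x - ln y) <= x - y.
Proof.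
move=> x0 y0; have xy0 : 0 < x / y by rewrite divr_gt0.
have : ln (1 + (x / y - 1)) <= x / y - 1 by apply: le_ln1Dx; lra.
rewrite addrC subrK ln_div ?posrE// => xy.
have : y * (ln x - ln y) <= y * (x / y - 1) by rewrite ler_pM2l.
by rewrite [y * (x / y - 1)]mulrBr mulr1 [y * (x / y)]mulrC divfK ?gt_eqF.
Qed.

(** [ln_div_le] at x = h, y = z^alpha. With h a free constant the bound is linear in z^alpha, so it
    survives integration and summation; the best h is chosen only at the end. *)
Lemma powR_ln_ge (z h : R) : 0 <= z -> 0 < h ->
  (ln h + 1) * z `^ alpha - h <= alpha * (z `^ alpha * ln z).
Proof.
case/andP: alpha01 => a0 _; rewrite le_eqVlt => /predU1P[<-|z0] h0.
  by rewrite powR0 ?gt_eqF// mul0r !mulr0 sub0r oppr_le0 ltW.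
have := ln_div_le h0 (powR_gt0 alpha z0); rewrite ln_powR.
rewrite -subr_ge0 => H; rewrite -subr_ge0; move: H; congr (_ <= _); ring.
Qed.

(** [ln_div_le] at x = z^(1 - alpha), y = k, multiplied by z^alpha / k; k is a free constant like h
    above. *)
Lemma powR_ln_le (z k : R) : 0 <= z -> 0 < k ->
  (1 - alpha) * (z `^ alpha * ln z) <= (ln k - 1) * z `^ alpha + z / k.
Proof.
case/andP: alpha01 => a0 a1; rewrite le_eqVlt => /predU1P[<-|z0] k0.
  by rewrite powR0 ?gt_eqF// !mul0r !mulr0 addr0.
have := ln_div_le (powR_gt0 (1 - alpha) z0) k0; rewrite ln_powR => lnk.
have zE : z = z `^ alpha * z `^ (1 - alpha).
  rewrite -powRD; last by rewrite (gt_eqF z0) implybT.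
  by rewrite addrC subrK powRr1 ?ltW.
have zk : z / k = z `^ alpha * (z `^ (1 - alpha) / k) by rewrite mulrA -zE.
rewrite zk; have := powR_gt0 alpha z0; move: (z `^ alpha) => u u0.
have le_q : (1 - alpha) * ln z - ln k <= z `^ (1 - alpha) / k - 1.
  rewrite -(ler_pM2l k0) [k * (_ / k - 1)]mulrBr mulr1.
  by rewrite [k * (_ / k)]mulrC divfK// gt_eqF.
have := ler_wpM2l (ltW u0) le_q.
rewrite -subr_ge0 => H; rewrite -subr_ge0; move: H; congr (_ <= _); ring.
Qed.

Lemma powR_le1D (x : R) : (0 <= x) -> (x `^ alpha <= 1 + x).
Proof.
case/andP: alpha01 => a0 a1 x0; have [x1|x1] := leP 1 x.
  by have := ler1_powR x1 (ltW a1); lra.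
apply: (@le_trans _ _ 1); last by lra.
have -> : 1 = (1 `^ alpha) :> R by rewrite powR1.
by apply: ge0_ler_powR; rewrite ?nnegrE//; lra.
Qed.

End tangent.

(** * Integrals of Z, Z^alpha and Z^alpha log Z as real numbers *)

Lemma measurable_lne (R : realType) : measurable_fun [set: \bar R] (@lne R).
Proof.
rewrite (_ : @lne R = fun x => if x <= 0 then -oo else
    if x == +oo then +oo else (ln (fine x))%:E); last first.
  by apply/funext => -[r| |] //=; rewrite leNye.
apply: measurable_fun_ifT => //; first exact: measurable_fun_lee.
apply: measurable_fun_ifT => //; first exact: measurable_fun_eqe.
by apply/measurable_EFinP; exact: measurableT_comp.
Qed.

Section density_integrals.
Context d (T : measurableType d) (R : realType).
Context (mu : {finite_measure set T -> \bar R}) (Z : T -> \bar R) (alpha : R).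
Hypothesis alpha01 : (0 < alpha < 1)%R.
Hypothesis Z_ge0 : forall x, 0 <= Z x.
Hypothesis iZ : mu.-integrable [set: T] Z.

Local Notation z := (fun x => fine (Z x)).
Local Notation G := (fun x => (fine (Z x) `^ alpha)%R).
Local Notation L := (fun x => (fine (Z x) `^ alpha * ln (fine (Z x)))%R).

Let mZ : measurable_fun [set: T] Z. Proof. exact: measurable_int iZ. Qed.

Lemma measurable_fineZ : measurable_fun [set: T] z.
Proof. exact: measurableT_comp. Qed.

Lemma fineZ_ge0 x : (0 <= z x)%R. Proof. by rewrite fine_ge0. Qed.

Lemma measurable_fineZ_powR : measurable_fun [set: T] G.
Proof. exact: (measurableT_comp (measurable_powR _) measurable_fineZ). Qed.

Lemma measurable_fineZ_powRln : measurable_fun [set: T] L.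
Proof.
apply: measurable_funM; first exact: measurable_fineZ_powR.
exact: (measurableT_comp (@measurable_ln R) measurable_fineZ).
Qed.

(** Z may take the value +oo, but being integrable only on a null set; this lets every integral be
    computed with the real function [fine (Z x)]. *)
Lemma ae_fineZ : {ae mu, forall x, Z x = (z x)%:E}.
Proof.
have := integrable_ae measurableT iZ.
by apply: filterS => x /(_ Logic.I) /fineK.
Qed.

Lemma integrable_fineZ : mu.-integrable [set: T] (EFin \o z).
Proof.
apply: le_integrable iZ => //; first exact/measurable_EFinP/measurable_fineZ.
move=> x _ /=; have := Z_ge0 x; case: (Z x) => //= _.
by rewrite leey.
Qed.

Lemma integrable_affine_fineZ (a b : R) :
  mu.-integrable [set: T] (EFin \o (fun x => a + b * z x)%R).
Proof.
rewrite (_ : _ \o _ = (EFin \o cst a) \+ (fun x => b%:E * (EFin \o z) x)).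
  apply: integrableD => //; first exact: finite_measure_integrable_cst.
  by apply: integrableZl => //; exact: integrable_fineZ.
by apply/funext.
Qed.

Lemma integrable_fineZ_powR : mu.-integrable [set: T] (EFin \o G).
Proof.
apply: le_integrable (integrable_affine_fineZ 1 1) => //.
  exact/measurable_EFinP/measurable_fineZ_powR.
move=> x _ /=; rewrite lee_fin mul1r ger0_norm ?powR_ge0//.
apply: le_trans (ler_norm _); exact: (powR_le1D alpha01 (fineZ_ge0 x)).
Qed.

(** The two tangent inequalities at h = k = 1 confine z^alpha log z between -1/alpha and z/(1 -
    alpha). *)
Lemma integrable_fineZ_powRln : mu.-integrable [set: T] (EFin \o L).
Proof.
case/andP: (alpha01) => a0 a1; have b0 : (0 < 1 - alpha)%R by rewrite subr_gt0.
apply: le_integrable (integrable_affine_fineZ alpha^-1 (1 - alpha)^-1) => //.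
  exact/measurable_EFinP/measurable_fineZ_powRln.
move=> x _ /=; rewrite lee_fin; apply: le_trans (ler_norm _).
have z0 := fineZ_ge0 x.
have := powR_ln_ge alpha01 z0 ltr01; have := powR_ln_le alpha01 z0 ltr01.
rewrite ln1 divr1 !add0r mul1r mulN1r.
have := powR_ge0 (fine (Z x)) alpha.
move: (fine (Z x) `^ alpha)%R => u u0.
move: (u * _)%R => w w_le w_ge.
have iz : (0 <= (1 - alpha)^-1 * fine (Z x))%R by rewrite mulr_ge0// invr_ge0 ltW.
have ia : (0 < alpha^-1)%R by rewrite invr_gt0.
rewrite ler_norml; apply/andP; split.
  rewrite lerNl -(ler_pM2l a0) mulrDr divff ?gt_eqF//.
  have := mulr_ge0 (ltW a0) iz; lra.
rewrite -(ler_pM2l b0) mulrDr mulVKf ?gt_eqF//.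
have := mulr_ge0 (ltW b0) (ltW ia); lra.
Qed.

Variables (B : set T) (mB : measurable B).

Lemma integral_fineE (f : T -> \bar R) (g : T -> R) :
  measurable_fun [set: T] f -> mu.-integrable [set: T] (EFin \o g) ->
  {ae mu, forall x, f x = (g x)%:E} ->
  \int[mu]_(x in B) f x = (\int[mu]_(x in B) g x)%R%:E.
Proof.
move=> mf ig fg.
have igB : mu.-integrable B (EFin \o g) by exact: integrableS ig.
rewrite /Rintegral fineK; last exact: integrable_fin_num.
apply: ae_eq_integral => //; first exact: measurable_funTS.
  exact: measurable_int igB.
by apply: filterS fg => x.
Qed.

Lemma integral_ZE : \int[mu]_(x in B) Z x = (\int[mu]_(x in B) z x)%R%:E.
Proof. by apply: integral_fineE => //; [exact: integrable_fineZ|exact: ae_fineZ]. Qed.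

Lemma integral_ZpowE :
  \int[mu]_(x in B) (Z x `^ alpha) = (\int[mu]_(x in B) G x)%R%:E.
Proof.
apply: integral_fineE; last by apply: filterS ae_fineZ => x ->.
  exact: (measurableT_comp (measurable_poweR _)).
exact: integrable_fineZ_powR.
Qed.

Lemma measurable_Zpowlne :
  measurable_fun [set: T] (fun x => Z x `^ alpha * lne (Z x)).
Proof.
apply: emeasurable_funM; first exact: (measurableT_comp (measurable_poweR _)).
exact: (measurableT_comp (@measurable_lne R)).
Qed.

Lemma integral_ZpowlneE :
  \int[mu]_(x in B) (Z x `^ alpha * lne (Z x)) = (\int[mu]_(x in B) L x)%R%:E.
Proof.
apply: integral_fineE; first exact: measurable_Zpowlne.
  exact: integrable_fineZ_powRln.
apply: filterS ae_fineZ => x Zx; have := fineZ_ge0 x; rewrite Zx /=.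
rewrite le_eqVlt => /predU1P[<-|z0]; last by rewrite leNgt z0.
(* At a zero of Z the factor Z^alpha = 0 annihilates [lne 0 = -oo], and both integrands are 0. *)
by case/andP: alpha01 => a0 _; rewrite lexx powR0 ?gt_eqF// !mul0e mul0r.
Qed.

Let iB (f : T -> R) : mu.-integrable [set: T] (EFin \o f) ->
  mu.-integrable B (EFin \o f).
Proof. by move=> /integrableS; exact. Qed.

Lemma Rintegral_powR_ln_ge (h : R) : (0 < h)%R ->
  ((ln h + 1) * (\int[mu]_(x in B) G x) - h * fine (mu B)
    <= alpha * \int[mu]_(x in B) L x)%R.
Proof.
move=> h0; have iG := iB integrable_fineZ_powR.
have iL := iB integrable_fineZ_powRln.
rewrite -!RintegralZl// -Rintegral_cst//.
have ic : mu.-integrable B (EFin \o (fun=> h)).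
  exact: (@finite_measure_integrable_cst _ _ _ mu).
have iaG : mu.-integrable B (EFin \o (fun x => (ln h + 1) * G x)%R).
  exact: (integrableZl mB _ iG).
rewrite -RintegralB//; apply: le_Rintegral => //.
- exact: (integrableB mB iaG ic).
- exact: (integrableZl mB _ iL).
- by move=> x _; exact: powR_ln_ge (fineZ_ge0 x) h0.
Qed.

Lemma Rintegral_powR_ln_le (k : R) : (0 < k)%R ->
  ((1 - alpha) * \int[mu]_(x in B) L x <=
    (ln k - 1) * (\int[mu]_(x in B) G x) + k^-1 * \int[mu]_(x in B) z x)%R.
Proof.
move=> k0; have iG := iB integrable_fineZ_powR.
have iL := iB integrable_fineZ_powRln.
have iz := iB integrable_fineZ.
rewrite -!RintegralZl//.
have iaG : mu.-integrable B (EFin \o (fun x => (ln k - 1) * G x)%R).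
  exact: (integrableZl mB _ iG).
have ibz : mu.-integrable B (EFin \o (fun x => k^-1 * z x)%R).
  exact: (integrableZl mB _ iz).
rewrite -RintegralD//; apply: le_Rintegral => //.
- exact: (integrableZl mB _ iL).
- exact: (integrableD mB iaG ibz).
- by move=> x _; rewrite [(k^-1 * _)%R]mulrC; exact: powR_ln_le (fineZ_ge0 x) k0.
Qed.

End density_integrals.

(** * Covers nearly optimal for several costs, and the bounds on Psi and Xi *)

Section common_cover.
Context (R : realType) (X : pointedType) (S : X -> X) (F : set (set X)).
Local Notation T := (A0type S F).
Context (phi0 Lam : {finite_measure set T -> \bar R}) (Z : T -> \bar R).
Hypothesis bijS : bijective S.
Hypothesis Lam_inv : forall A : set T, measurable A -> Lam (S @^-1` A) = Lam A.
Hypothesis Z_ge0 : forall x, 0 <= Z x.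
Hypothesis mZ : measurable_fun [set: T] Z.
Hypothesis Z_density : forall A : set T, measurable A ->
  Lam A = \int[phi0]_(x in A) Z x.
Variable alpha : R.
Hypothesis alpha01 : (0 < alpha < 1)%R.
Implicit Types (Q : set X) (A : nat -> set X) (e : R).

Local Notation fa := (cost S (int_pow phi0 Z alpha)).
Local Notation f0 := (cost S phi0).
Local Notation f1 := (cost S Lam).

Lemma measurable_Zpow : measurable_fun [set: T] (fun x => Z x `^ alpha).
Proof. exact: (measurableT_comp (measurable_poweR _)). Qed.

Lemma int_pow_le (B : set T) : measurable B -> int_pow phi0 Z alpha B <= phi0 B + Lam B.
Proof.
move=> mB; rewrite Z_density// /int_pow -[phi0 B]mul1e -integral_cst//.
rewrite -ge0_integralD//; last exact: measurable_funTS.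
apply: ge0_le_integral => //.
- by move=> x _; exact: poweR_ge0.
- by apply: measurable_funTS; exact: measurable_Zpow.
- by apply: emeasurable_funD => //; exact: measurable_funTS.
move=> x _ /=; have := Z_ge0 x; case: (Z x) => [z|_|//]; last by rewrite leey.
by rewrite !lee_fin; exact: (powR_le1D alpha01).
Qed.

Lemma int_pow_ge0 B : 0 <= int_pow phi0 Z alpha B.
Proof. by apply: integral_ge0 => x _; exact: poweR_ge0. Qed.

Lemma measurable_pullback Q A n :
  covers S F Q A -> measurable (Spreim S n%:Z (A n) : set T).
Proof. by move=> cA; exact: (covers_shift_cover bijS cA).1. Qed.

Lemma cost_ge0 mu A : (forall B, 0 <= mu B) -> 0 <= cost S mu A :> \bar R.
Proof. by move=> mu0; exact: nneseries_ge0. Qed.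

Lemma fa_le Q A : covers S F Q A -> fa A <= f0 A + f1 A.
Proof.
move=> cA; rewrite /cost -nneseriesD//; apply: lee_nneseries => [n _ _|n _].
  exact: int_pow_ge0.
by apply: int_pow_le; exact: measurable_pullback cA.
Qed.

Lemma inf_cost_le mu Q A :
  covers S F Q A -> inf_cost S F mu Q <= cost S mu A :> \bar R.
Proof. by move=> cA; apply: ereal_inf_lbound; exists A. Qed.

Lemma inf_cost_fin (mu : {finite_measure set T -> \bar R}) Q :
  inf_cost S F mu Q \is a fin_num.
Proof.
rewrite ge0_fin_numE; last first.
  by apply: le_ereal_inf_tmp => _ [A _ <-]; exact: cost_ge0.
have [A cA SA] : exists2 A, covers S F Q A &
    forall n, Spreim S n%:Z (A n) = if n is 0%N then setT else set0.
  apply: shift_cover_covers => //; split; first by case.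
  by move=> x _; exists 0%N => //; exists x.
apply: (le_lt_trans (inf_cost_le mu cA)).
rewrite /cost nneseries_recl// SA eseries0 ?adde0.
  by rewrite -ge0_fin_numE// fin_num_measure.
by move=> [//|n] _ _; rewrite SA measure0.
Qed.

Lemma inf_cost_adherent mu Q e : inf_cost S F mu Q \is a fin_num -> (0 < e)%R ->
  exists2 A, covers S F Q A & cost S mu A < inf_cost S F mu Q + e%:E :> \bar R.
Proof.
move=> fi e0; have [_ [A cA <-] lA] := lb_ereal_inf_adherent e0 fi.
by exists A.
Qed.

(** The cost for phi + Lam' is the sum of the two costs, and [shift_inf_add_le] bounds its infimum
    by costs taken on two unrelated covers; a nearly optimal cover for the sum then replaces
    both. *)
Lemma common_cover_add (phi Lam' : {measure set T -> \bar R}) Q A B e :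
  phi setT < +oo ->
  (forall C : set T, measurable C -> Lam' (S @^-1` C) = Lam' C) ->
  covers S F Q A -> covers S F Q B ->
  cost S phi A < +oo -> cost S Lam' B < +oo -> (0 < e)%R ->
  exists2 C, covers S F Q C &
    cost S phi C + cost S Lam' C < cost S phi A + cost S Lam' B + e%:E.
Proof.
move=> phiT inv cA cB fA fB e0.
pose psi := measure_add phi Lam'.
have le_psi := @shift_inf_add_le _ T R S bijS (@measurable_shift _ S F)
  phi Lam' psi Q _ _ phiT inv (fun C _ => measure_addE _ _ C)
  (covers_shift_cover bijS cA) (covers_shift_cover bijS cB).
have : shift_inf (S : T -> T) psi Q < cost S phi A + cost S Lam' B + e%:E.
  apply: (le_lt_trans le_psi); rewrite lteDl ?lte_fin//.
  by rewrite ge0_fin_numE ?adde_ge0 ?lte_add_pinfty// nneseries_ge0.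
case/ereal_inf_lt => _ [D cD <-] Dlt.
have [C cC CD] := shift_cover_covers bijS cD.
exists C => //; apply: le_lt_trans Dlt; rewrite /cost -nneseriesD//.
by apply: lee_nneseries => [n _ _|n _]; rewrite ?adde_ge0// CD -measure_addE.
Qed.

(** Makes the Z^alpha cost the cost of a measure, so that it can enter the non-invariant argument
    phi of [common_cover_add]. *)
Lemma int_pow_measure :
  exists nu : {measure set T -> \bar R}, forall B, nu B = int_pow phi0 Z alpha B.
Proof.
have nu0 : int_pow phi0 Z alpha set0 = 0 by exact: integral_set0.
have nu_ge0 B : 0 <= int_pow phi0 Z alpha B by exact: int_pow_ge0.
have nu_sigma : semi_sigma_additive (int_pow phi0 Z alpha : set T -> \bar R).
  apply: semi_sigma_additive_nng_induced; first exact: measurable_Zpow.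
  by move=> x; exact: poweR_ge0.
pose m := isMeasure.Build _ T R (int_pow phi0 Z alpha) nu0 nu_ge0 nu_sigma.
by exists (HB.pack_for {measure set T -> \bar R} (int_pow phi0 Z alpha) m).
Qed.

Lemma C0_mono Q e1 e2 : (e1 <= e2)%R -> C0 phi0 Q e1 `<=` C0 phi0 Q e2.
Proof. exact: below_mono. Qed.

Lemma C1_mono Q e1 e2 : (e1 <= e2)%R -> C1 Lam Q e1 `<=` C1 Lam Q e2.
Proof. exact: below_mono. Qed.

(** The sum of the two costs exceeds the sum of the infima by less than three errors e/3; as neither
    cost is below its own infimum, each excess is less than e. *)
Lemma common_cover2 Q e : (0 < e)%R -> exists2 C, covers S F Q C &
  f0 C < Phi phi0 Q + e%:E /\ f1 C < LamX Lam Q + e%:E.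
Proof.
move=> e0; have e3 : (0 < e / 3)%R by rewrite divr_gt0.
have [A cA fA] := inf_cost_adherent (inf_cost_fin phi0 Q) e3.
have [B cB fB] := inf_cost_adherent (inf_cost_fin Lam Q) e3.
have lty (mu : {finite_measure set T -> \bar R}) D :
    cost S mu D < inf_cost S F mu Q + (e / 3)%:E -> cost S mu D < +oo.
  move/lt_trans; apply; rewrite lte_add_pinfty ?ltry//.
  rewrite -ge0_fin_numE ?inf_cost_fin//.
  by apply: le_ereal_inf_tmp => _ [? _ <-]; exact: cost_ge0.
have [|C cC] := common_cover_add _ Lam_inv cA cB (lty _ _ fA) (lty _ _ fB) e3.
  by rewrite -ge0_fin_numE// fin_num_measure.
move=> fC; exists C => //.
have fCy : f0 C + f1 C < +oo.
  apply: (lt_trans fC); rewrite lte_add_pinfty ?ltry// lte_add_pinfty//.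
    exact: lty fA.
  exact: lty fB.
have f0C : f0 C \is a fin_num.
  rewrite ge0_fin_numE ?cost_ge0//; apply: le_lt_trans fCy.
  by rewrite leeDl// cost_ge0.
have f1C : f1 C \is a fin_num.
  rewrite ge0_fin_numE ?cost_ge0//; apply: le_lt_trans fCy.
  by rewrite leeDr// cost_ge0.
have := inf_cost_le phi0 cC; have := inf_cost_le Lam cC.
rewrite /Phi /LamX.
have /fineK f0A : f0 A \is a fin_num by rewrite ge0_fin_numE ?cost_ge0//; exact: lty fA.
have /fineK f1B : f1 B \is a fin_num by rewrite ge0_fin_numE ?cost_ge0//; exact: lty fB.
move: fA fB fC; rewrite -f0A -f1B -(fineK f0C) -(fineK f1C).
rewrite -(fineK (inf_cost_fin phi0 Q)) -(fineK (inf_cost_fin Lam Q)).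
rewrite -!EFinD !lte_fin !lee_fin => *; split; lra.
Qed.

Lemma H0_ge0 Q : 0 <= H0 phi0 Z alpha Q.
Proof.
apply: (lim_inf0_ge (C0_mono (Q := Q)) ltr01) => A _.
by apply: cost_ge0 => B; exact: int_pow_ge0.
Qed.

(** [common_cover2] gives, at every tolerance, covers with both the phi0 cost and the Lam cost
    bounded, and Z^alpha <= 1 + Z then bounds the Z^alpha cost uniformly. *)
Lemma H0_fin Q : H0 phi0 Z alpha Q \is a fin_num.
Proof.
rewrite ge0_fin_numE ?H0_ge0//.
apply: (@le_lt_trans _ _ (Phi phi0 Q + 1 + (LamX Lam Q + 1))); last first.
  by rewrite !lte_add_pinfty ?ltry// ltey_eq inf_cost_fin.
apply: lim_inf0_le (C0_mono (Q := Q)) _ _ => e e0.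
have m0 : (0 < Num.min e 1)%R by rewrite lt_min e0 ltr01.
have [C cC [fC0 fC1]] := common_cover2 Q m0; exists C.
  split => //; apply: (lt_le_trans fC0); rewrite leeD2l// lee_fin.
  by rewrite ge_min lexx.
apply: (le_trans (fa_le cC)); apply: leeD.
  by apply: (le_trans (ltW fC0)); rewrite leeD2l// lee_fin ge_min lexx orbT.
by apply: (le_trans (ltW fC1)); rewrite leeD2l// lee_fin ge_min lexx orbT.
Qed.

(* A large weight [K] on the costs of [phi0] and [Lam] forces both to be almost
   optimal, while the cost of [Z ^ alpha] stays below its optimal value. *)
Lemma common_cover3 Q e : (0 < e)%R -> exists2 C, covers S F Q C &
  [/\ f0 C < Phi phi0 Q + e%:E, f1 C < LamX Lam Q + e%:E &
      fa C < H0 phi0 Z alpha Q + e%:E].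
Proof.
move=> e0; have e4 : (0 < e / 4)%R by rewrite divr_gt0.
have h0 : (0 <= fine (H0 phi0 Z alpha Q))%R by rewrite fine_ge0 ?H0_ge0.
(* Four errors e/4 = K d leave K (f0 - Phi) + K (f1 - Lambda) + fa < H + e = K e. All three terms on
   the left are nonnegative, so each is less than K e, which is the claim. *)
pose K := ((fine (H0 phi0 Z alpha Q) + e) / e)%R.
have K0 : (0 < K)%R by rewrite divr_gt0//; lra.
have Ke : (K * e = fine (H0 phi0 Z alpha Q) + e)%R by rewrite /K divfK// gt_eqF.
have d0 : (0 < e / 4 / K)%R by rewrite divr_gt0.
have Kd : (K * (e / 4 / K) = e / 4)%R by rewrite mulrC divfK// gt_eqF.
set d := (e / 4 / K)%R in d0 Kd.
have [A [cA fA0] fAa] := lim_inf0_lt (C0_mono (Q := Q))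
  (v := H0 phi0 Z alpha Q + (e / 4)%:E) (f := fa)
  (ltac:(by rewrite lteDl ?lte_fin// H0_fin)) d0.
have [B cB fB] := inf_cost_adherent (inf_cost_fin Lam Q) d0.
have [nu nuE] := int_pow_measure.
pose KK := NngNum (ltW K0).
pose phi := measure_add (mscale KK phi0) nu.
pose KLam := mscale KK Lam.
have phiE D : cost S phi D = K%:E * f0 D + fa D.
  rewrite /cost -nneseriesZl//.
  rewrite -nneseriesD//; last 2 first.
  - by move=> n _ _; rewrite mule_ge0// lee_fin ltW.
  - by move=> n _ _; exact: int_pow_ge0.
  by apply: eq_eseriesr => n _; rewrite /phi measure_addE nuE.
have KLamE D : cost S KLam D = K%:E * f1 D.
  by rewrite /cost -nneseriesZl.
have fA0' : f0 A \is a fin_num.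
  rewrite ge0_fin_numE ?cost_ge0//; apply: (lt_trans fA0).
  by rewrite lte_add_pinfty ?ltry// ltey_eq inf_cost_fin.
have fAa' : fa A \is a fin_num.
  rewrite ge0_fin_numE; last by apply: cost_ge0 => D; exact: int_pow_ge0.
  by apply: (lt_trans fAa); rewrite lte_add_pinfty ?ltry// ltey_eq H0_fin.
have fB' : f1 B \is a fin_num.
  rewrite ge0_fin_numE ?cost_ge0//; apply: (lt_trans fB).
  by rewrite lte_add_pinfty ?ltry// ltey_eq inf_cost_fin.
have [| | | |C cC] := @common_cover_add phi KLam Q A B (e / 4) _ _ cA cB _ _ e4.
- rewrite [X in X < _](measure_addE (mscale KK phi0) nu setT) nuE lte_add_pinfty//.
    by rewrite lte_mul_pinfty// ?lee_fin ?ltW// ltey_eq fin_num_measure.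
  apply: (le_lt_trans (int_pow_le measurableT)).
  by rewrite lte_add_pinfty// ltey_eq fin_num_measure.
- by move=> D mD; congr (_ * _); exact: Lam_inv.
- by rewrite phiE ltey_eq fin_numD fAa' fin_numM.
- by rewrite KLamE ltey_eq fin_numM.
rewrite !phiE !KLamE => fC.
have fCy : K%:E * f0 C + fa C + K%:E * f1 C < +oo.
  apply: (lt_trans fC); rewrite ltey_eq !fin_numD//.
  by rewrite !fin_numM ?fA0' ?fAa' ?fB'.
have Kf0 : 0 <= K%:E * f0 C by rewrite mule_ge0 ?cost_ge0// lee_fin ltW.
have Kf1 : 0 <= K%:E * f1 C by rewrite mule_ge0 ?cost_ge0// lee_fin ltW.
have fa0 : 0 <= fa C by apply: cost_ge0 => D; exact: int_pow_ge0.
have fCa : fa C \is a fin_num.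
  rewrite ge0_fin_numE//; apply: le_lt_trans fCy.
  by rewrite -addeA addeCA leeDl// adde_ge0.
have KN0 : K%:E != 0 by rewrite eqe gt_eqF.
have fC0 : f0 C \is a fin_num.
  rewrite ge0_fin_numE ?cost_ge0// ltNge leye_eq; apply/negP => /eqP f0y.
  move: fCy; rewrite f0y gt0_muley ?lte_fin// -addeA addye ?ltxx//.
  by rewrite gt_eqF// (lt_le_trans ltNy0)// adde_ge0.
have fC1 : f1 C \is a fin_num.
  rewrite ge0_fin_numE ?cost_ge0// ltNge leye_eq; apply/negP => /eqP f1y.
  move: fCy; rewrite f1y gt0_muley ?lte_fin// addey ?ltxx//.
  by rewrite gt_eqF// (lt_le_trans ltNy0)// adde_ge0.
exists C => //.
have := inf_cost_le phi0 cC; have := inf_cost_le Lam cC.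
move: fA0 fAa fB fC fa0; rewrite /Phi /LamX.
rewrite -(fineK fA0') -(fineK fAa') -(fineK fB').
rewrite -(fineK fC0) -(fineK fCa) -(fineK fC1).
rewrite -(fineK (inf_cost_fin phi0 Q)) -(fineK (inf_cost_fin Lam Q)).
rewrite -(fineK (H0_fin Q)) -!EFinM -!EFinD !lte_fin !lee_fin.
move: (fine _) h0 Ke => h h0 Ke.
move: (fine _) (fine _) (fine _) (fine _) (fine _) (fine _) (fine _) (fine _).
move=> *; split; nra.
Qed.

Lemma integrable_Z : phi0.-integrable [set: T] Z.
Proof.
apply/integrableP; split => //; under eq_integral do rewrite gee0_abs//.
by rewrite -Z_density// -ge0_fin_numE// fin_num_measure.
Qed.

Lemma C01_mono Q e1 e2 : (e1 <= e2)%R -> C01 phi0 Lam Q e1 `<=` C01 phi0 Lam Q e2.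
Proof. by move=> e12; apply: below_mono => //; exact: C1_mono. Qed.

Lemma Ca1_mono Q e1 e2 :
  (e1 <= e2)%R -> Ca1 phi0 Z alpha Q e1 `<=` Ca1 phi0 Z alpha Q e2.
Proof. by move=> e12; apply: below_mono => //; exact: C0_mono. Qed.

Lemma Ca01_mono Q e1 e2 :
  (e1 <= e2)%R -> Ca01 phi0 Lam Z alpha Q e1 `<=` Ca01 phi0 Lam Z alpha Q e2.
Proof. by move=> e12; apply: below_mono => //; exact: C01_mono. Qed.

Lemma PhiL_Phi Q : PhiL phi0 Lam Q = Phi phi0 Q.
Proof.
apply/eqP; rewrite eq_le; apply/andP; split; last first.
  by apply: (lim_inf0_ge (C1_mono (Q := Q)) ltr01) => A [cA _]; exact: inf_cost_le.
apply/lee_addgt0Pr => e e0; apply: lim_inf0_le (C1_mono (Q := Q)) _ _ => e' e'0.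
have m0 : (0 < Num.min e e')%R by rewrite lt_min e0.
have [C cC [fC0 fC1]] := common_cover2 Q m0; exists C.
  by split => //; apply: (lt_le_trans fC1); rewrite leeD2l// lee_fin ge_min lexx orbT.
by apply: (le_trans (ltW fC0)); rewrite leeD2l// lee_fin ge_min lexx.
Qed.

Lemma C01_C0 Q e : C01 phi0 Lam Q e `<=` C0 phi0 Q e.
Proof. by move=> A [[cA _]]; rewrite PhiL_Phi. Qed.

(** The families [C01] lie inside [C0], which gives one inequality; [common_cover3] puts covers of
    nearly optimal Z^alpha cost into every [C01], which gives the other. *)
Lemma H01_H0 Q : H01 phi0 Lam Z alpha Q = H0 phi0 Z alpha Q.
Proof.
apply/eqP; rewrite eq_le; apply/andP; split.
  apply/lee_addgt0Pr => e e0; apply: lim_inf0_le (C01_mono (Q := Q)) _ _ => e' e'0.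
  have m0 : (0 < Num.min e e')%R by rewrite lt_min e0.
  have [C cC [fC0 fC1 fCa]] := common_cover3 Q m0; exists C.
    split; last first.
      rewrite PhiL_Phi; apply: (lt_le_trans fC0).
      by rewrite leeD2l// lee_fin ge_min lexx orbT.
    by split => //; apply: (lt_le_trans fC1); rewrite leeD2l// lee_fin ge_min lexx orbT.
  by apply: (le_trans (ltW fCa)); rewrite leeD2l// lee_fin ge_min lexx.
rewrite /H0 lim_inf0E; last exact: C0_mono.
apply: ge_ereal_sup => _ [e /= e0 <-].
apply: (lim_inf0_ge (C01_mono (Q := Q)) e0) => A /C01_C0 cA.
by apply: ereal_inf_lbound; exists A.
Qed.

Lemma Ca01_Ca1 Q e : Ca01 phi0 Lam Z alpha Q e `<=` Ca1 phi0 Z alpha Q e.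
Proof. by move=> A []; rewrite H01_H0 => /C01_C0. Qed.

(** The covers defining Xi are among those defining Psi, and by [common_cover3] they exist at every
    tolerance, so the supremum is never over the empty set. *)
Lemma Psi1_le_Xi1 Q : Psi1 phi0 Z alpha Q <= Xi1 phi0 Lam Z alpha Q.
Proof.
apply: lim_inf0_le_lim_sup0.
- exact: Ca1_mono.
- exact: Ca01_mono.
- by move=> e _; exact: Ca01_Ca1.
move=> e e0; have [C cC [fC0 fC1 fCa]] := common_cover3 Q e0; exists C.
by split; [split; [split|rewrite PhiL_Phi]|rewrite H01_H0].
Qed.

Section cost_powlog.
Variables (Q : set X) (C : nat -> set X).
Hypothesis cC : covers S F Q C.
Hypothesis faC : fa C \is a fin_num.
Let D n : set T := Spreim S n%:Z (C n).
Let mD n : measurable (D n). Proof. exact: measurable_pullback cC. Qed.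
Let z (x : T) := fine (Z x).
Let g n := (\int[phi0]_(x in D n) (z x `^ alpha))%R.
Let l n := (\int[phi0]_(x in D n) (z x `^ alpha * ln (z x)))%R.
Local Notation fl := (cost S (int_powlog phi0 Z alpha)).

Let faE : fa C = \sum_(0 <= n <oo) (g n)%:E.
Proof.
by apply: eq_eseriesr => n _; exact: integral_ZpowE integrable_Z _ (mD n).
Qed.

Let flE : fl C = \sum_(0 <= n <oo) (l n)%:E.
Proof.
by apply: eq_eseriesr => n _; exact: integral_ZpowlneE integrable_Z _ (mD n).
Qed.

Let cvg_g : series g @ \oo --> fine (fa C).
Proof.
rewrite faE; apply: nneseries_cvg_fine; last by rewrite -faE.
by move=> n; apply: Rintegral_ge0 => x _; exact: powR_ge0.
Qed.

(** The integrated tangent inequality is summed over n; only the minorant needs to converge. *)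
Lemma cost_powlog_ge h : (0 < h)%R -> f0 C \is a fin_num ->
  (((ln h + 1) * fine (fa C) - h * fine (f0 C)) / alpha)%:E <= fl C.
Proof.
case/andP: (alpha01) => a0 _ h0 f0C; rewrite flE.
pose p n := fine (phi0 (D n)).
have f0E : f0 C = \sum_(0 <= n <oo) (p n)%:E.
  by apply: eq_eseriesr => n _; rewrite fineK// fin_num_measure.
have cvg_p : series p @ \oo --> fine (f0 C).
  rewrite f0E; apply: nneseries_cvg_fine; last by rewrite -f0E.
  by move=> n; rewrite fine_ge0.
apply: (eseries_ge (v := fun n => (ln h + 1) / alpha * g n + - h / alpha * p n)%R).
  move=> n; rewrite -(ler_pM2l a0).
  apply: le_trans (Rintegral_powR_ln_ge alpha01 Z_ge0 integrable_Z (mD n) h0).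
  by rewrite mulrDr !mulrA ![(alpha * _ / alpha)%R]mulrAC divff ?gt_eqF// !mul1r mulNr.
have -> : (((ln h + 1) * fine (fa C) - h * fine (f0 C)) / alpha =
    ((ln h + 1) / alpha * fine (fa C) + - h / alpha * fine (f0 C)))%R.
  by rewrite mulrBl mulrAC [(h * _ / _)%R]mulrAC mulNr mulNr.
exact: cvg_series_lin.
Qed.

Lemma cost_powlog_le k : (0 < k)%R -> f1 C \is a fin_num ->
  fl C <= (((ln k - 1) * fine (fa C) + fine (f1 C) / k) / (1 - alpha))%:E.
Proof.
case/andP: (alpha01) => _; rewrite -subr_gt0 => b0 k0 f1C; rewrite flE.
pose q n := (\int[phi0]_(x in D n) z x)%R.
have f1E : f1 C = \sum_(0 <= n <oo) (q n)%:E.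
  apply: eq_eseriesr => n _; rewrite Z_density; last exact: mD.
  exact: (integral_ZE Z_ge0 integrable_Z (mD n)).
have cvg_q : series q @ \oo --> fine (f1 C).
  rewrite f1E; apply: nneseries_cvg_fine; last by rewrite -f1E.
  by move=> n; apply: Rintegral_ge0 => x _; rewrite fine_ge0.
apply: (eseries_le (v := fun n =>
    (ln k - 1) / (1 - alpha) * g n + k^-1 / (1 - alpha) * q n)%R).
  move=> n; rewrite -(ler_pM2l b0).
  apply: (le_trans (Rintegral_powR_ln_le alpha01 Z_ge0 integrable_Z (mD n) k0)).
  rewrite mulrDr !mulrA ![((1 - alpha) * _ / (1 - alpha))%R]mulrAC.
  by rewrite divff ?gt_eqF// !mul1r.
have -> : (((ln k - 1) * fine (fa C) + fine (f1 C) / k) / (1 - alpha) =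
    ((ln k - 1) / (1 - alpha) * fine (fa C) +
    k^-1 / (1 - alpha) * fine (f1 C)))%R.
  by rewrite mulrDl mulrAC [(_ / k)%R]mulrC [(k^-1 * _ / _)%R]mulrAC.
exact: cvg_series_lin.
Qed.

End cost_powlog.

(** [Ca1] bounds the Z^alpha cost from above only. The lower bound holds on [C0] at a small enough
    tolerance, because H is the limit of the infima over [C0]. *)
Lemma H0_near Q e : (0 < e)%R -> exists2 e', (0 < e')%R &
  forall A, Ca1 phi0 Z alpha Q e' A -> fa A \is a fin_num /\
    (`|fine (fa A) - fine (H0 phi0 Z alpha Q)| <= e)%R.
Proof.
move=> e0; have Hf := H0_fin Q.
have Hlt : H0 phi0 Z alpha Q - e%:E < H0 phi0 Z alpha Q.
  by rewrite lteBlDr// lteDl ?lte_fin.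
have [e' e'0 He'] := lim_inf0_gt (C0_mono (Q := Q)) Hlt.
exists (Num.min e e'); first by rewrite lt_min e0.
move=> A [cA fA].
have : C0 phi0 Q e' A.
  by apply: (C0_mono _ cA); rewrite ge_min lexx orbT.
move/He' => Afa.
have {}fA : fa A < H0 phi0 Z alpha Q + e%:E.
  by apply: (lt_le_trans fA); rewrite leeD2l// lee_fin ge_min lexx.
have faA : fa A \is a fin_num.
  rewrite ge0_fin_numE; last by apply: cost_ge0 => D; exact: int_pow_ge0.
  by apply: (lt_trans fA); rewrite lte_add_pinfty ?ltry// ltey_eq Hf.
split => //; move: Afa fA; rewrite -(fineK faA) -(fineK Hf) /=.
rewrite -EFinB -EFinD !lte_fin ler_distl => ? ?; apply/andP; split; lra.
Qed.

Lemma Psi1_ge Q h : (0 < h)%R ->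
  (((ln h + 1) * fine (H0 phi0 Z alpha Q) - h * fine (Phi phi0 Q)) / alpha)%:E
    <= Psi1 phi0 Z alpha Q.
Proof.
move=> h0; case/andP: (alpha01) => a0 _; apply/lee_subgt0Pr => e e0.
set a := (ln h + 1)%R; have c0 : (0 < `|a| + h)%R by rewrite ltr_pwDr.
(* An error d in the Z^alpha cost contributes at most |a| d and an error d in the phi0 cost at most
   h d; after division by alpha the total is e. *)
pose d := (e * alpha / (`|a| + h))%R.
have d0 : (0 < d)%R by rewrite divr_gt0// mulr_gt0.
have dE : (d * (`|a| + h) = e * alpha)%R by rewrite /d divfK// gt_eqF.
have [e' e'0 He'] := H0_near Q d0.
have m0 : (0 < Num.min d e')%R by rewrite lt_min d0.
apply: (lim_inf0_ge (Ca1_mono (Q := Q)) m0) => A cA.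
have [|faA] := He' A; first by apply: (Ca1_mono _ cA); rewrite ge_min lexx orbT.
case: cA => -[cA fA0] _ dA.
have {}fA0 : f0 A < Phi phi0 Q + d%:E.
  by apply: (lt_le_trans fA0); rewrite leeD2l// lee_fin ge_min lexx.
have Pf : Phi phi0 Q \is a fin_num by exact: inf_cost_fin.
have f0A : f0 A \is a fin_num.
  rewrite ge0_fin_numE ?cost_ge0//; apply: (lt_trans fA0).
  by rewrite lte_add_pinfty ?ltry// ltey_eq Pf.
apply: le_trans (cost_powlog_ge cA faA h0 f0A).
rewrite -EFinB lee_fin ler_pdivlMr// mulrBl divfK ?gt_eqF// -dE.
move: fA0; rewrite -(fineK f0A) -(fineK Pf) -EFinD lte_fin /= => fA0.
have : (a * (fine (H0 phi0 Z alpha Q) - fine (fa A)) <= `|a| * d)%R.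
  apply: (le_trans (ler_norm _)); rewrite normrM ler_wpM2l//.
  by rewrite distrC.
have : (h * fine (f0 A) <= h * (fine (Phi phi0 Q) + d))%R.
  by rewrite ler_pM2l// ltW.
rewrite -/a mulrBr !mulrDr ![(d * _)%R]mulrC; lra.
Qed.

Lemma Xi1_le Q k : (0 < k)%R ->
  Xi1 phi0 Lam Z alpha Q <=
  (((ln k - 1) * fine (H0 phi0 Z alpha Q) + fine (LamX Lam Q) / k) /
   (1 - alpha))%:E.
Proof.
move=> k0; case/andP: (alpha01) => _; rewrite -subr_gt0 => b0.
apply/lee_addgt0Pr => e e0.
set a := (ln k - 1)%R; have c0 : (0 < `|a| + k^-1)%R by rewrite ltr_pwDr// invr_gt0.
(* The same balance as for Psi, with the Lam cost weighted by 1/k and division by 1 - alpha. *)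
pose d := (e * (1 - alpha) / (`|a| + k^-1))%R.
have d0 : (0 < d)%R by rewrite divr_gt0// mulr_gt0.
have dE : (d * (`|a| + k^-1) = e * (1 - alpha))%R by rewrite /d divfK// gt_eqF.
have [e' e'0 He'] := H0_near Q d0.
have m0 : (0 < Num.min d e')%R by rewrite lt_min d0.
apply: (lim_sup0_le (Ca01_mono (Q := Q)) m0) => A cA.
have [|faA] := He' A.
  by apply: Ca01_Ca1; apply: (Ca01_mono _ cA); rewrite ge_min lexx orbT.
case: cA => -[[cA fA1] _] _ dA.
have {}fA1 : f1 A < LamX Lam Q + d%:E.
  by apply: (lt_le_trans fA1); rewrite leeD2l// lee_fin ge_min lexx.
have Lf : LamX Lam Q \is a fin_num by exact: inf_cost_fin.
have f1A : f1 A \is a fin_num.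
  rewrite ge0_fin_numE ?cost_ge0//; apply: (lt_trans fA1).
  by rewrite lte_add_pinfty ?ltry// ltey_eq Lf.
apply: (le_trans (cost_powlog_le cA faA k0 f1A)).
rewrite -EFinD lee_fin ler_pdivrMr// [X in (_ <= X)%R]mulrDl divfK ?gt_eqF// -dE.
move: fA1; rewrite -(fineK f1A) -(fineK Lf) -EFinD lte_fin /= => fA1.
have : (a * (fine (fa A) - fine (H0 phi0 Z alpha Q)) <= `|a| * d)%R.
  by apply: (le_trans (ler_norm _)); rewrite normrM ler_wpM2l.
have : (k^-1 * fine (f1 A) <= k^-1 * (fine (LamX Lam Q) + d))%R.
  by rewrite ler_pM2l ?invr_gt0// ltW.
rewrite -/a mulrBr !mulrDr ![(d * _)%R]mulrC ![(_ / k)%R]mulrC; lra.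
Qed.

End common_cover.

(** * Monotonicity of w e^w and the two Lambert branches *)

Section lambert.
Context (R : realType).
Implicit Types (a b w x : R).
Local Open Scope ring_scope.

(** For a < 0, the bound e^t > 1 + t at t = a - b reduces the claim to (b - a)(1 + a) >= 0. *)
Lemma mulr_expR_incr a b : -1 <= a -> a < b -> a * expR a < b * expR b.
Proof.
move=> a1 ab; have [a0|a0] := ltP a 0; last first.
  apply: (@le_lt_trans _ _ (a * expR b)).
    by rewrite ler_wpM2l// ler_expR ltW.
  by rewrite ltr_pM2r ?expR_gt0.
have := @expR_gt1Dx R (a - b); rewrite subr_eq0 lt_eqF// => /(_ isT) t.
have ae : a * expR (a - b) < b.
  apply: (@lt_le_trans _ _ (a * (1 + (a - b)))); first by rewrite ltr_nM2l.
  nra.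
by rewrite -[X in a * expR X](subrK b) expRD mulrA ltr_pM2r ?expR_gt0.
Qed.

Lemma mulr_expR_decr a b : b <= -1 -> a < b -> b * expR b < a * expR a.
Proof.
move=> b1 ab; have b0 : b < 0 by lra.
have := @expR_gt1Dx R (b - a); rewrite subr_eq0 gt_eqF// => /(_ isT) t.
have be : b * expR (b - a) < a.
  apply: (@lt_le_trans _ _ (b * (1 + (b - a)))); first by rewrite ltr_nM2l.
  nra.
by rewrite -[X in b * expR X](subrK a) expRD mulrA ltr_pM2r ?expR_gt0.
Qed.

Lemma mulr_expR_ge w : - expR (-1) <= w * expR w.
Proof.
rewrite -[leLHS]mulN1r; have [w1|w1|->//] := ltgtP w (-1).
  by apply: ltW; apply: mulr_expR_decr.
by apply: ltW; apply: mulr_expR_incr.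
Qed.

Lemma mulr_expR_IVT a b x : a <= b ->
  Num.min (a * expR a) (b * expR b) <= x <= Num.max (a * expR a) (b * expR b) ->
  exists2 w, a <= w <= b & w * expR w = x.
Proof.
move=> ab xab.
have cont : {within `[a, b], continuous (fun w : R => w * expR w)}.
  apply: continuous_subspaceT => w; apply: cvgM; first exact: cvg_id.
  exact: continuous_expR.
by have [w] := IVT ab cont xab; rewrite in_itv /= => ? ?; exists w.
Qed.

Lemma lambertWP x : - expR (-1) <= x <= 0 ->
  -1 <= lambertW x /\ lambertW x * expR (lambertW x) = x.
Proof.
move=> /andP[x1 x0]; rewrite /lambertW.
apply: (@xgetPex _ 0 [set w : R | -1 <= w /\ w * expR w = x]).
have [||w /andP[w1 _] wx] := @mulr_expR_IVT (-1) 0 x; last by exists w.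
  by lra.
by rewrite mul0r mulN1r ge_min x1 le_max x0 orbT.
Qed.

Lemma lambertWm1P x : - expR (-1) <= x < 0 ->
  exists2 w, lambertWm1 x = w%:E & w <= -1 /\ w * expR w = x.
Proof.
move=> /andP[x1 x0]; rewrite /lambertWm1 lt_eqF//.
set W := xget _ _; exists W => //.
apply: (@xgetPex _ (-1) [set w : R | w <= -1 /\ w * expR w = x]).
(* -t is a left endpoint for the intermediate value theorem: e^t >= (t/2)^2 gives t e^(-t) <= 4/t <=
   -x, and the summand 1 makes -t < -1. *)
pose t := 4 / - x + 1; have ix : 0 < 4 / - x by rewrite divr_gt0// oppr_gt0.
have t1 : 1 < t by rewrite /t; lra.
have xt : x <= - t * expR (- t).
  have e2 : (t / 2) ^+ 2 <= expR t.
    rewrite {2}(_ : t = t / 2 + t / 2); last lra.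
    rewrite expRD expr2; have := expR_ge1Dx (t / 2); nra.
  rewrite expRN mulNr lerNr ler_pdivrMr ?expR_gt0//.
  have x4 : 4 = - x * (4 / - x) by rewrite mulrC divfK// oppr_eq0 lt_eqF.
  have : 4 <= - x * t by rewrite /t; lra.
  nra.
have [||w /andP[_ w1] wx] := @mulr_expR_IVT (- t) (-1) x; last by exists w.
  by lra.
by rewrite mulN1r ge_min x1 orbT le_max xt.
Qed.

(** A w above W(x) or below W_{-1}(x) would, by monotonicity on that side of -1, have w e^w > x. At
    x = 0 the lower bound is the convention -oo. *)
Lemma lambert_bounds w x : w * expR w <= x <= 0 ->
  (lambertWm1 x <= w%:E)%E /\ w <= lambertW x.
Proof.
move=> /andP[wx x0]; have x1 := le_trans (mulr_expR_ge w) wx.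
split; last first.
  have [|W1 Wx] := @lambertWP x; first by rewrite x1.
  rewrite leNgt; apply/negP => /(mulr_expR_incr W1); rewrite Wx; lra.
have [->|xN0] := eqVneq x 0; first by rewrite /lambertWm1 eqxx leNye.
have [|W -> [W1 Wx]] := @lambertWm1P x.
  by rewrite x1 lt_neqAle xN0.
by rewrite lee_fin leNgt; apply/negP => /(mulr_expR_decr W1); rewrite Wx; lra.
Qed.

End lambert.

(** * Optimising the free constants of the tangent bounds *)

Section tangent_optimization.
Context (R : realType) (alpha H P X Phi La : R).
Hypothesis alpha01 : (0 < alpha < 1)%R.
Local Open Scope ring_scope.
Hypothesis H0 : 0 < H.
Hypothesis Phi0 : 0 <= Phi.
Hypothesis La0 : 0 <= La.
Hypothesis P_ge : forall h : R, 0 < h -> ((ln h + 1) * H - h * Phi) / alpha <= P.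
Hypothesis X_le : forall k : R, 0 < k -> X <= ((ln k - 1) * H + La / k) / (1 - alpha).

Lemma tangent_Phi_gt0 : 0 < Phi.
Proof.
case/andP: alpha01 => a0 _; rewrite lt_neqAle Phi0 andbT; apply/eqP => PhiE.
(* If Phi were 0, the bound would grow with ln h without limit; this h already gives P + H/alpha <=
   P. *)
have := P_ge (expR_gt0 (alpha * P / H)).
rewrite expRK -PhiE mulr0 subr0 mulrDl mul1r divfK ?gt_eqF//.
by rewrite ler_pdivrMr// [P * _]mulrC leNgt ltrDl H0.
Qed.

Lemma tangent_La_gt0 : 0 < La.
Proof.
case/andP: alpha01 => _; rewrite -subr_gt0 => b0.
rewrite lt_neqAle La0 andbT; apply/eqP => LaE.
have := X_le (expR_gt0 ((1 - alpha) * X / H)).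
rewrite expRK -LaE mul0r addr0 mulrBl mul1r divfK ?gt_eqF//.
by rewrite ler_pdivlMr// [X * _]mulrC leNgt ltrBlDr ltrDl H0.
Qed.

Lemma tangent_bound :
  X - P <= - (H / (alpha * (1 - alpha)) *
              ln (H / (Phi `^ (1 - alpha) * La `^ alpha))).
Proof.
have F0 := tangent_Phi_gt0; have L0 := tangent_La_gt0.
case/andP: (alpha01) => a0; rewrite -subr_gt0 => b0.
rewrite ln_div ?posrE ?mulr_gt0 ?powR_gt0//.
rewrite lnM ?posrE ?powR_gt0// !ln_powR.
(* h = H/Phi maximises the lower bound on P and k = La/H minimises the upper bound on X. *)
have := P_ge (divr_gt0 H0 F0); have := X_le (divr_gt0 L0 H0).
rewrite !ln_div ?posrE// divfK ?gt_eqF//.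
have -> : La / (La / H) = H by rewrite invf_div mulrC divfK ?gt_eqF.
rewrite ler_pdivlMr// ler_pdivrMr// => Xb Pa.
rewrite mulrAC -mulNr ler_pdivlMr ?mulr_gt0//.
set b := 1 - alpha in b0 Xb *; have bE : b = 1 - alpha by [].
have := ler_wpM2l (ltW a0) Xb; have := ler_wpM2l (ltW b0) Pa.
rewrite bE; nra.
Qed.

End tangent_optimization.

(** * Reduction to real numbers and the two-sided Lambert estimate *)

Theorem proposition7 (R : realType) (X : pointedType) (S : X -> X)
  (F : set (set X))
  (phi0 Lam : {finite_measure set (A0type S F) -> \bar R})
  (Z : A0type S F -> \bar R) (Q : set X) (alpha : R)
  (bijS : bijective S)
  (sigmaF : sigma_algebra [set: X] F)
  (Lam_inv : forall A : set (A0type S F), measurable A ->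
    Lam (S @^-1` A) = Lam A)
  (Lam_phi0 : Lam `<< phi0)
  (Z_ge0 : forall x, 0 <= Z x)
  (mZ : measurable_fun [set: A0type S F] Z)
  (Z_density : forall A : set (A0type S F), measurable A ->
    Lam A = \int[phi0]_(x in A) Z x)
  (BQ : sigB S F Q)
  (alpha01 : (0 < alpha < 1)%R)
  (H_gt0 : 0 < H0 phi0 Z alpha Q) :
  let H := H0 phi0 Z alpha Q in
  let Psi := Psi1 phi0 Z alpha Q in
  let Xi := Xi1 phi0 Lam Z alpha Q in
  let c := Phi phi0 Q `^ (1 - alpha) * LamX Lam Q `^ alpha in
  let x := (alpha * (1 - alpha))%:E * (Psi - Xi) / c in
  Xi - Psi <= - (H / (alpha * (1 - alpha))%:E * lne (H / c))
  /\
  ((- (expR (-1))%:E <= x <= 0) /\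
   expeR (lambertWm1 (fine x)) * c <= H
     <= expeR (lambertW (fine x))%:E * c).
Proof.
have Hf := H0_fin bijS Lam_inv Z_ge0 mZ Z_density alpha01 Q.
have Psi_le_Xi := Psi1_le_Xi1 bijS Lam_inv Z_ge0 mZ Z_density alpha01 Q.
have Psi_ge h := @Psi1_ge _ _ _ _ _ _ _ bijS Lam_inv Z_ge0 mZ Z_density _ alpha01 Q h.
have Xi_le k := @Xi1_le _ _ _ _ _ _ _ bijS Lam_inv Z_ge0 mZ Z_density _ alpha01 Q k.
have Phif : Phi phi0 Q \is a fin_num by exact: (inf_cost_fin bijS).
have Lamf : LamX Lam Q \is a fin_num by exact: (inf_cost_fin bijS).
have Phi_ge0 : 0 <= Phi phi0 Q.
  by apply: le_ereal_inf_tmp => _ [A _ <-]; exact: cost_ge0.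
have Lam_ge0 : 0 <= LamX Lam Q.
  by apply: le_ereal_inf_tmp => _ [A _ <-]; exact: cost_ge0.
(* The tangent bounds at k = 1 and h = 1 exclude Xi = +oo and Psi = -oo; Psi <= Xi then makes both
   finite. *)
have Xify : Xi1 phi0 Lam Z alpha Q < +oo.
  exact: le_lt_trans (Xi_le _ ltr01) (ltry _).
have PsifNy : -oo < Psi1 phi0 Z alpha Q.
  exact: lt_le_trans (ltNyr _) (Psi_ge _ ltr01).
have Xif : Xi1 phi0 Lam Z alpha Q \is a fin_num.
  by rewrite fin_real// Xify (lt_le_trans PsifNy).
have Psif : Psi1 phi0 Z alpha Q \is a fin_num.
  by rewrite fin_real// PsifNy (le_lt_trans Psi_le_Xi).
move=> H Psi Xi c x; rewrite {}/x {}/c {}/H {}/Psi {}/Xi.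
move: H_gt0 Phi_ge0 Lam_ge0 Psi_le_Xi Psi_ge Xi_le.
move: (H0 _ _ _ _) Hf (Psi1 _ _ _ _) Psif (Xi1 _ _ _ _ _) Xif (Phi _ _) Phif
  (LamX _ _) Lamf {Xify PsifNy}.
move=> [H| |]// _ [P| |]// _ [Xi| |]// _ [f| |]// _ [l| |]// _.
rewrite !lee_fin lte_fin /= => H0 f0 l0 PXi P_ge Xi_le.
have f_gt0 := tangent_Phi_gt0 alpha01 H0 f0 P_ge.
have l_gt0 := tangent_La_gt0 alpha01 H0 l0 Xi_le.
have := tangent_bound alpha01 H0 f0 l0 P_ge Xi_le.
have : (0 < f `^ (1 - alpha) * l `^ alpha)%R by rewrite mulr_gt0 ?powR_gt0.
rewrite -[((f `^ (1 - alpha))%:E * _)%E]EFinM.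
move: (f `^ (1 - alpha) * l `^ alpha)%R => c c0 bound.
have b0 : (0 < alpha * (1 - alpha))%R.
  by case/andP: alpha01 => a0 a1; rewrite mulr_gt0// subr_gt0.
move: (alpha * (1 - alpha))%R b0 bound => b b0 bound.
have Hc0 : (0 < H / c)%R by rewrite divr_gt0.
rewrite !inver !gt_eqF// -!EFinM -EFinD lne_EFin// -EFinM -EFinN lee_fin.
split; first exact: bound.
set x := (_ * _ / c)%R; set w := ln (H / c).
have HE : H = (expR w * c)%R by rewrite lnK ?posrE// divfK// gt_eqF.
(* Since e^w = H/c, the left inequality is (i) multiplied by alpha (1 - alpha) / c; the right one is
   Psi <= Xi. *)
have wx : (w * expR w <= x <= 0)%R.
  rewrite /x lnK ?posrE// mulrA ler_pM2r ?invr_gt0//; apply/andP; split.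
    have := ler_wpM2l (ltW b0) bound; rewrite -/w mulrN mulrA.
    by rewrite [(b * (H / b))%R]mulrC divfK ?gt_eqF// -[(P - Xi)%R]opprB mulrN lerNr mulrC.
  by rewrite pmulr_lle0 ?invr_gt0// pmulr_rle0// subr_le0.
have [Wm1 W] := lambert_bounds wx; have [wx1 x0] := andP wx.
(* The minimum -1/e of w e^w puts x in the domain of the Lambert branches. *)
split; first by rewrite !lee_fin x0 andbT (le_trans (mulr_expR_ge w)).
apply/andP; split; last by rewrite {1}HE ler_pM2r// ler_expR.
rewrite {1}HE [(expR w * c)%:E]EFinM lee_pmul2r// (_ : (expR w)%:E = expeR w%:E)//.
by rewrite lee_expeR.
Qed.
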